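(* Let $A$ be a commutative $C^*$-algebra with spectrum $\Delta(A)$ and let $\sigma : A \to A$ be an automorphism. The modular two-sided ideals of $\ell_1^{\widehat{\sigma}}(\mathbb{Z}, C_0(\Delta(A)))$ which are maximal and contain the (closed) commutator ideal $\mathscr{C}$ are precisely the ideals $I(x, \xi)$, where $x \in \mathrm{Per}^1(\Delta(A))$ and $\xi \in \mathbb{T}$.
   Context: $A$ is not assumed unital; it is identified with $C_0(\Delta(A))$ by the Gelfand transform. The automorphism $\sigma$ induces a homeomorphism $\widetilde{\sigma}:\Delta(A)\to\Delta(A)$, $\widetilde{\sigma}(\mu)=\mu\circ\sigma^{-1}$, and an automorphism $\widehat{\sigma}$ of $C_0(\Delta(A))$, $\widehat{\sigma}(f)=f\circ\widetilde{\sigma}^{-1}$. The Banach algebra $\ell_1^{\widehat{\sigma}}(\mathbb{Z}, C_0(\Delta(A)))$ is the set of formal sums $\sum_{n\in\mathbb{Z}} f_n\delta^n$ with $f_n\in C_0(\Delta(A))$ and $\sum_n\|f_n\|<\infty$, with norm $\sum_n\|f_n\|$, coefficientwise addition and scalar multiplication, and (twisted convolution) multiplication determined by $(f_n\delta^n)*(g_m\delta^m)=f_n\cdot\widehat{\sigma}^n(g_m)\,\delta^{n+m}$. $\mathscr{C}$ is the closed two-sided ideal generated by all commutators $a*b-b*a$. Ideals are two-sided throughout. $\mathrm{Per}^1(\Delta(A))=\{x\in\Delta(A) : \widetilde{\sigma}(x)=x\}$ and $\mathbb{T}$ is the unit circle in $\mathbb{C}$. For $x\in\mathrm{Per}^1(\Delta(A))$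 and $\xi\in\mathbb{T}$, $I(x,\xi)$ is the kernel of the unique non-zero multiplicative linear functional $\mu$ on $\ell_1^{\widehat{\sigma}}(\mathbb{Z}, C_0(\Delta(A)))$ such that $\mu(f_n\delta^n)=f_n(x)\xi^n$ for all $n\in\mathbb{Z}$ and $f_n\in C_0(\Delta(A))$. *)

(* Defs.v *)
From HB Require Import structures.
From mathcomp Require Import all_boot all_order all_algebra.
From mathcomp Require Import complex.
From mathcomp Require Import all_classical all_reals.
From mathcomp Require Import zify.
From mathcomp Require Import ereal function_spaces topology normedtype sequences esum.

Set Implicit Arguments.
Unset Strict Implicit.
Unset Printing Implicit Defensive.

Import Order.TTheory GRing.Theory Num.Theory.
Import Normc.

#[local] Arguments normc {R} x.
Import numFieldNormedType.Exports.

Local Open Scope classical_set_scope.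
Local Open Scope ring_scope.
Local Open Scope complex_scope.

(* The product is an operation on a complex Banach space rather than a MathComp
   ring structure, since no unit is assumed. *)
HB.mixin Record NormedModule_isCommCStarAlgebra (R : realType) A
    & CompleteNormedModule R[i] A := {
  cmul : A -> A -> A ;
  cstar : A -> A ;
  cmulA : associative cmul ;
  cmulC : commutative cmul ;
  cmul_linear : forall b, linear (cmul^~ b) ;
  cmul_norm : forall a b, `|cmul a b| <= `|a| * `|b| ;
  cstarK : involutive cstar ;
  cstarD : {morph cstar : a b / a + b} ;
  cstarZ : forall (z : R[i]) a, cstar (z *: a) = z^*%C *: cstar a ;
  cstarM : forall a b, cstar (cmul a b) = cmul (cstar b) (cstar a) ;
  cstar_norm : forall a, `|cmul (cstar a) a| = `|a| ^+ 2
}.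

#[short(type="commCStarAlgType")]
HB.structure Definition CommCStarAlgebra (R : realType) :=
  {A of NormedModule_isCommCStarAlgebra R A & CompleteNormedModule R[i] A}.

Section Algebra.
Context {R : realType}.

(* Ideals, characters, etc. of a not necessarily unital algebra, given by a vector
   space V and its product mul. Ideals are two-sided and are linear subspaces. *)
Section Ideals.
Context {V : lmodType R[i]} (mul : V -> V -> V).

Definition is_ideal (I : set V) :=
  [/\ I 0, (forall (z : R[i]) a b, I a -> I b -> I (z *: a + b)) &
      forall a b, I b -> I (mul a b) /\ I (mul b a)].

(* V / I has an identity, namely the class of u. *)
Definition is_modular (I : set V) :=
  exists u, forall a, I (a - mul u a) /\ I (a - mul a u).

Definition is_maximal_ideal (I : set V) :=
  [/\ is_ideal I, I != setT &
      forall J, is_ideal J -> I `<=` J -> J = I \/ J = setT].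

Definition is_character (mu : V -> R[i]^o) :=
  [/\ linear mu, (forall a b, mu (mul a b) = mu a * mu b) &
      exists a, mu a != 0].
End Ideals.

Definition commutator_ideal {V : normedModType R[i]} (mul : V -> V -> V) : set V :=
  \bigcap_(I in [set I | [/\ is_ideal mul I, closed I &
                             forall a b, I (mul a b - mul b a)]]) I.
End Algebra.

(* Non-zero characters. As a type it carries the topology induced by {ptws A -> C},
   which is the weak-* topology. *)
Definition spectrum {R : realType} (A : commCStarAlgType R) :
  set {ptws A -> R[i]^o} := [set mu | is_character (@cmul R A) mu].
Arguments spectrum {R} A _.

Section C0.
Context (R : realType) (X : topologicalType).
Implicit Types f g : X -> R[i]^o.

Definition vanishes_at_infinity f := forall e : R, 0 < e ->
  exists2 K : set X, compact K & forall x, ~ K x -> normc (f x) < e.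

Definition C0_pred : {pred X -> R[i]^o} :=
  [pred f : X -> R[i]^o | `[< continuous f /\ vanishes_at_infinity f >]].

Lemma C0_predP f : reflect (continuous f /\ vanishes_at_infinity f) (f \in C0_pred).
Proof. exact: asboolP. Qed.

Lemma normcZ (z w : R[i]^o) : normc (z *: w) = normc z * normc w.
Proof. exact: normcM. Qed.

Lemma normc_ge0 (z : R[i]) : 0 <= normc z.
Proof. by case: z => a b; exact: sqrtr_ge0. Qed.

Lemma normc_continuous : continuous (normc : R[i]^o -> R).
Proof.
move=> z; have zF : Filter (nbhs (z : R[i]^o)) by exact: nbhs_filter.
apply/cvgrPdist_lt => e e0.
exists e%:C; first by rewrite /= ltcR.
move=> w; rewrite /ball_/= => zwe.
have : `|z - w| < e%:C by [].
rewrite -[X in X < _]/((normc (z - w))%:C) ltcR; apply: le_lt_trans.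
rewrite ler_norml; apply/andP; split.
  rewrite lerNl opprB lerBlDr -(normcN (z - w)) opprB.
  by rewrite -[X in normc X <= _](subrK z w); exact: le_normcD.
by rewrite lerBlDr -[X in normc X <= _](subrK w z); exact: le_normcD.
Qed.

Lemma C0_bounded f : f \in C0_pred -> has_ubound (range (normc \o f)).
Proof.
move=> /C0_predP[cf /(_ 1 ltr01)[K cK Kf]].
have /compact_bounded : compact ((normc \o f) @` K).
  apply: continuous_compact => //; apply: continuous_subspaceT => x.
  by apply: continuous_comp; [exact: cf | exact: normc_continuous].
move=> [M [_ /(_ (`|M| + 1))]] h.
exists (Num.max 1 (`|M| + 1)) => _ [x _ <-] /=; rewrite le_max.
have [Kx|/Kf/ltW->//] := pselect (K x).
have -> : normc (f x) <= `|M| + 1; last by rewrite orbT.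
apply: le_trans (ler_norm _) _; apply: h; last by exists x.
by rewrite ltr_pwDr// ler_norm.
Qed.

Fact C0_submod : submod_closed C0_pred.
Proof.
split.
  apply/C0_predP; split; first exact: cst_continuous.
  by move=> e e0; exists set0; [exact: compact0|move=> x _; rewrite normc0].
move=> z f g fC gC; have [M Mf] := C0_bounded fC.
move: fC gC => /C0_predP[cf vf] /C0_predP[cg vg].
apply/C0_predP; split.
  by move=> x; apply: cvgD; [apply: cvgZr; exact: cf|exact: cg].
move=> e e0; have n0 : 0 < normc z + 1 by rewrite ltr_wpDl// normc_ge0.
have [K cK Kf] := vf (e / 2 / (normc z + 1)) (divr_gt0 (divr_gt0 e0 (ltr0Sn R 1)) n0).
have [L cL Lg] := vg (e / 2) (divr_gt0 e0 (ltr0Sn R 1)).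
exists (K `|` L); first exact: compactU.
move=> x /not_orP[/Kf Kx /Lg Lx]; apply: le_lt_trans (le_normcD _ _) _.
rewrite (splitr e) ltr_leD ?(ltW Lx)//.
rewrite normcZ; apply: le_lt_trans (_ : (normc z + 1) * normc (f x) < _).
  by rewrite ler_wpM2r ?normc_ge0// lerDl.
by rewrite mulrC -ltr_pdivlMr.
Qed.
HB.instance Definition _ := GRing.isSubmodClosed.Build R[i] (X -> R[i]^o) C0_pred C0_submod.

Record C0 := MkC0 { C0_val :> X -> R[i]^o ; C0_valP : C0_val \in C0_pred }.
HB.instance Definition _ := [isSub for C0_val].
HB.instance Definition _ := [Choice of C0 by <:].
HB.instance Definition _ := [SubChoice_isSubLmodule of C0 by <:].

Definition supnorm (f : C0) : R := sup (range (normc \o f)).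


Lemma supnorm_ub (f : C0) x : normc (f x) <= supnorm f.
Proof. by apply: ub_le_sup; [exact: C0_bounded (C0_valP f) | exists x]. Qed.

Lemma supnorm_le (f : C0) M : 0 <= M -> (forall x, normc (f x) <= M) ->
  supnorm f <= M.
Proof.
move=> M0 fM; rewrite /supnorm.
have [->|/set0P ne] := eqVneq (range (normc \o f)) set0; first by rewrite sup0.
by apply: ge_sup => // _ [x _ <-]; exact: fM.
Qed.

Lemma supnorm_ge0 (f : C0) : 0 <= supnorm f.
Proof.
rewrite /supnorm; have [->|/set0P[_ [x _ _]]] := eqVneq (range (normc \o f)) set0.
  by rewrite sup0.
exact: le_trans (normc_ge0 _) (supnorm_ub f x).
Qed.

Lemma supnormD (f g : C0) : supnorm (f + g) <= supnorm f + supnorm g.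
Proof.
apply: supnorm_le => [|x]; first by rewrite addr_ge0 ?supnorm_ge0.
by apply: le_trans (le_normcD _ _) _; rewrite lerD ?supnorm_ub.
Qed.

Lemma supnormZ_le (z : R[i]) (f : C0) : supnorm (z *: f) <= normc z * supnorm f.
Proof.
apply: supnorm_le => [|x]; first by rewrite mulr_ge0 ?supnorm_ge0 ?normc_ge0.
by rewrite [X in X <= _]normcM ler_wpM2l ?normc_ge0 ?supnorm_ub.
Qed.

Lemma supnormZ (z : R[i]) (f : C0) : supnorm (z *: f) = normc z * supnorm f.
Proof.
apply/eqP; rewrite eq_le supnormZ_le /=.
have [->|z0] := eqVneq z 0; first by rewrite normc0 mul0r supnorm_ge0.
have nz : 0 < normc z.
  by rewrite lt_neqAle normc_ge0 andbT eq_sym; apply: contra z0 => /eqP/eq0_normc ->.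
have := supnormZ_le z^-1 (z *: f).
rewrite scalerA mulVf// scale1r normcV => h.
by rewrite -ler_pdivlMl.
Qed.

Lemma supnorm_eq0 (f : C0) : supnorm f = 0 -> f = 0.
Proof.
move=> f0; apply/val_inj/funext => x; apply: eq0_normc; apply/eqP.
by rewrite eq_le normc_ge0 andbT -f0 supnorm_ub.
Qed.

Lemma supnorm0 : supnorm 0 = 0.
Proof. by rewrite -[X in supnorm X](scale0r (0 : C0)) supnormZ normc0 mul0r. Qed.

Let C0_norm (f : C0) : R[i] := (supnorm f)%:C.
Let C0_normD (f g : C0) : C0_norm (f + g) <= C0_norm f + C0_norm g.
Proof. by rewrite /C0_norm -rmorphD lecR supnormD. Qed.
Let C0_normZ (z : R[i]) (f : C0) : C0_norm (z *: f) = `|z| * C0_norm f.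
Proof. by rewrite /C0_norm supnormZ rmorphM. Qed.
Let C0_norm_eq0 (f : C0) : C0_norm f = 0 -> f = 0.
Proof. by move=> [/supnorm_eq0]. Qed.
HB.instance Definition _ := Lmodule_isNormed.Build R[i] C0 C0_normD C0_normZ C0_norm_eq0.

Lemma C0_normE (f : C0) : `|f| = (supnorm f)%:C. Proof. by []. Qed.

Fact C0_mul_subproof (f g : C0) : (fun x => f x * g x) \in C0_pred.
Proof.
have [M Mf] := C0_bounded (C0_valP f).
have /C0_predP[cf _] := C0_valP f; have /C0_predP[cg vg] := C0_valP g.
apply/C0_predP; split.
  by move=> x; apply: (@cvgZ _ R[i]^o _ _ _ f g); [exact: cf|exact: cg].
have n0 : 0 < supnorm f + 1 by rewrite ltr_wpDl// supnorm_ge0.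
move=> e e0; have [K cK Kg] := vg (e / (supnorm f + 1)) (divr_gt0 e0 n0).
exists K => // x /Kg gx; rewrite normcM.
apply: le_lt_trans (_ : (supnorm f + 1) * normc (g x) < _).
  by rewrite ler_wpM2r ?normc_ge0// (le_trans (supnorm_ub f x))// lerDl.
by rewrite mulrC -ltr_pdivlMr.
Qed.
Definition C0_mul (f g : C0) : C0 := MkC0 (C0_mul_subproof f g).

Lemma supnormM (f g : C0) : supnorm (C0_mul f g) <= supnorm f * supnorm g.
Proof.
apply: supnorm_le => [|x]; first by rewrite mulr_ge0 ?supnorm_ge0.
by rewrite normcM ler_pM ?normc_ge0 ?supnorm_ub.
Qed.

Record homeomorphism := Homeomorphism {
  homeo_fun :> X -> X ;
  homeo_inv : X -> X ;
  homeo_fun_continuous : continuous homeo_fun ;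
  homeo_inv_continuous : continuous homeo_inv ;
  homeo_funK : cancel homeo_fun homeo_inv ;
  homeo_invK : cancel homeo_inv homeo_fun }.

Definition homeo_sym (h : homeomorphism) : homeomorphism :=
  Homeomorphism (@homeo_inv_continuous h) (@homeo_fun_continuous h)
                (@homeo_invK h) (@homeo_funK h).

Fact C0_aut_subproof (h : homeomorphism) (f : C0) : f \o homeo_inv h \in C0_pred.
Proof.
have /C0_predP[cf vf] := C0_valP f; apply/C0_predP; split.
  by move=> x; apply: continuous_comp; [exact: homeo_inv_continuous|exact: cf].
move=> e e0; have [K cK Kf] := vf e e0; exists (h @` K).
  by apply: continuous_compact => //; apply: continuous_subspaceT => x;
     exact: homeo_fun_continuous.
move=> x nKx /=; apply: Kf => Kx; apply: nKx.
by exists (homeo_inv h x) => //; rewrite homeo_invK.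
Qed.
Definition C0_aut (h : homeomorphism) (f : C0) : C0 := MkC0 (C0_aut_subproof h f).

Definition C0_autz (h : homeomorphism) (n : int) : C0 -> C0 :=
  match n with
  | Posz k => iter k (C0_aut h)
  | Negz k => iter k.+1 (C0_aut (homeo_sym h))
  end.

Lemma supnorm_aut h (f : C0) : supnorm (C0_aut h f) <= supnorm f.
Proof.
apply: supnorm_le => [|x]; first exact: supnorm_ge0.
exact: (supnorm_ub f (homeo_inv h x)).
Qed.

Lemma supnorm_autz h n (f : C0) : supnorm (C0_autz h n f) <= supnorm f.
Proof.
case: n => k /=; [|apply: (le_trans (supnorm_aut _ _))];
  by elim: k => [//|k IH] /=; exact: le_trans (supnorm_aut _ _) IH.
Qed.

End C0.

(* \sum_(n : int) u n, through symmetric partial sums; it is only used for absolutely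
   summable families of elements of the Banach space C0 R X. *)
Definition zsum {K : numFieldType} {V : normedModType K} (u : int -> V) : V :=
  limn (fun N => \sum_(i < N.*2.+1) u (i%:Z - N%:Z)).

Section Ell1.
Context (R : realType) (X : topologicalType).
Local Notation C0X := (C0 R X).

Definition ell1_pred : {pred int -> C0X} :=
  [pred a : int -> C0X | `[< summable [set: int] (fun n => (supnorm (a n))%:E) >]].

Lemma esum_supnormE (a : int -> C0X) :
  (\esum_(n in [set: int]) `|(supnorm (a n))%:E| =
   \esum_(n in [set: int]) (supnorm (a n))%:E)%E.
Proof. by apply: eq_esum => n _; rewrite gee0_abs// lee_fin supnorm_ge0. Qed.

Lemma ell1_predP (a : int -> C0X) :
  reflect (\esum_(n in [set: int]) (supnorm (a n))%:E < +oo)%E (a \in ell1_pred).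
Proof. by apply: (iffP (asboolP _)); rewrite /summable esum_supnormE. Qed.

Lemma esum_supnorm_ge0 (a : int -> C0X) :
  (0 <= \esum_(n in [set: int]) (supnorm (a n))%:E)%E.
Proof. by apply: esum_ge0 => n _; rewrite lee_fin supnorm_ge0. Qed.

Lemma esum_mull (I : choiceType) (c : R) (u : I -> R) : 0 <= c -> (forall i, 0 <= u i) ->
  (\esum_(n in [set: I]) (c * u n)%:E = c%:E * \esum_(n in [set: I]) (u n)%:E)%E.
Proof.
move=> c0 u0.
have le k (w : I -> R) : 0 <= k -> (forall i, 0 <= w i) ->
    (\esum_(n in [set: I]) (k * w n)%:E <= k%:E * \esum_(n in [set: I]) (w n)%:E)%E.
  move=> k0 w0; apply: ge_ereal_sup => _ [F [fF _] <-].
  rewrite fsumEFin// -mulr_fsumr.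
  rewrite EFinM lee_wpmul2l ?lee_fin//.
  by rewrite -fsumEFin//; apply: esum_ge; exists F.
apply/eqP; rewrite eq_le le//=.
have [->|cn0] := eqVneq c 0.
  by rewrite mul0e; apply: esum_ge0 => i _; rewrite mul0r.
have cgt : 0 < c by rewrite lt_neqAle eq_sym cn0.
have := le c^-1 (fun i => c * u i) _ _.
rewrite invr_ge0 => /(_ c0 (fun i => mulr_ge0 c0 (u0 i))).
under eq_esum do rewrite mulKf//.
by move=> h; rewrite muleC -lee_pdivlMr// muleC.
Qed.

Fact ell1_submod : submod_closed ell1_pred.
Proof.
split.
  by apply/ell1_predP; rewrite esum1// => n _; rewrite supnorm0.
move=> z a b /ell1_predP ha /ell1_predP hb; apply/ell1_predP.
apply: (@le_lt_trans _ _ (\esum_(n in [set: int])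
    ((normc z * supnorm (a n))%:E + (supnorm (b n))%:E))%E).
  apply: le_esum => n _; rewrite -EFinD lee_fin.
  by apply: le_trans (supnormD _ _) _; rewrite supnormZ.
rewrite esumD => [|n _|n _]; last 2 first.
- by rewrite lee_fin mulr_ge0 ?normc_ge0 ?supnorm_ge0.
- by rewrite lee_fin supnorm_ge0.
rewrite esum_mull ?normc_ge0// => [|n]; last exact: supnorm_ge0.
apply: lte_add_pinfty => //.
have : (\esum_(n in [set: int]) (supnorm (a n))%:E \is a fin_num)%E.
  by rewrite ge0_fin_numE// esum_supnorm_ge0.
by move=> /fineK <-; rewrite -EFinM ltry.
Qed.
HB.instance Definition _ :=
  GRing.isSubmodClosed.Build R[i] (int -> C0X) ell1_pred ell1_submod.

(* The formal sum \sum_n (coef n) delta^n, with summable coefficient norms. *)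
Record ell1 := MkEll1 { coef :> int -> C0X ; coefP : coef \in ell1_pred }.
HB.instance Definition _ := [isSub for coef].
HB.instance Definition _ := [Choice of ell1 by <:].
HB.instance Definition _ := [SubChoice_isSubLmodule of ell1 by <:].

Definition ell1norm (a : ell1) : R :=
  fine (\esum_(n in [set: int]) (supnorm (a n))%:E)%E.

Lemma ell1normE (a : ell1) :
  ((ell1norm a)%:E = \esum_(n in [set: int]) (supnorm (a n))%:E)%E.
Proof.
rewrite /ell1norm fineK// ge0_fin_numE ?esum_supnorm_ge0//.
exact/ell1_predP/coefP.
Qed.

Let ell1_norm (a : ell1) : R[i] := (ell1norm a)%:C.

Let ell1_normD (a b : ell1) : ell1_norm (a + b) <= ell1_norm a + ell1_norm b.
Proof.
rewrite /ell1_norm -rmorphD lecR -lee_fin EFinD !ell1normE -esumD.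
- by apply: le_esum => n _; rewrite -EFinD lee_fin supnormD.
- by move=> n _; rewrite lee_fin supnorm_ge0.
- by move=> n _; rewrite lee_fin supnorm_ge0.
Qed.

Let ell1_normZ (z : R[i]) (a : ell1) : ell1_norm (z *: a) = `|z| * ell1_norm a.
Proof.
rewrite /ell1_norm -[`|z|]/(normc z)%:C -rmorphM; congr (_%:C); apply: EFin_inj.
rewrite EFinM !ell1normE -esum_mull ?normc_ge0// => [|n]; last exact: supnorm_ge0.
by apply: eq_esum => n _; rewrite -supnormZ.
Qed.

Let ell1_norm_eq0 (a : ell1) : ell1_norm a = 0 -> a = 0.
Proof.
move=> [a0]; apply/val_inj/funext => n; apply: supnorm_eq0; apply/eqP.
rewrite eq_le supnorm_ge0 andbT -lee_fin -a0 ell1normE.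
by apply: esum_ge; exists [set n]; [split|rewrite fsbig_set1].
Qed.
HB.instance Definition _ :=
  Lmodule_isNormed.Build R[i] ell1 ell1_normD ell1_normZ ell1_norm_eq0.

Lemma zsum_supnorm (u : int -> C0X) :
  ((supnorm (zsum u))%:E <= \esum_(n in [set: int]) (supnorm (u n))%:E)%E.
Proof.
have := esum_supnorm_ge0 u.
case E : (\esum_(n in _) _)%E => [M| |//] M0; last exact: leey.
pose S N := \sum_(i < N.*2.+1) u (i%:Z - N%:Z).
have SM N : supnorm (S N) <= M.
  have : supnorm (S N) <= \sum_(i < N.*2.+1) supnorm (u (i%:Z - N%:Z)).
    rewrite /S; elim/big_ind2 : _ => // [|f x g y fx gy].
      by rewrite supnorm0.
    by apply: le_trans (supnormD _ _) _; exact: lerD.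
  move/le_trans; apply; rewrite -lee_fin -E; apply: esum_ge.
  exists [set i%:Z - N%:Z | i in `I_(N.*2.+1)].
    by split=> //; exact: finite_image.
  rewrite fsbig_image; last by move=> i j _ _ /addIr [].
  by rewrite -(fsbig_ord _ _ (fun i => (supnorm (u (i%:Z - N%:Z)))%:E)) sumEFin.
rewrite lee_fin /zsum -/S.
have [cS|/dvgP ->] := pselect (cvgn S); last first.
  by rewrite [X in X <= _]supnorm0.
apply/ler_addgt0Pr => e e0.
have [N _ /(_ N (leqnn N)) h] : \forall N \near \oo, `|limn S - S N| < e%:C.
  by move/cvgrPdist_lt : cS; apply; rewrite ltcR.
have : supnorm (limn S - S N) < e by rewrite -ltcR.
move=> /ltW h'; have := supnormD (limn S - S N) (S N).
by rewrite subrK => /le_trans; apply; rewrite addrC; exact: lerD.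
Qed.

Fact ell1_mul_subproof (h : homeomorphism X) (a b : ell1) :
  (fun n => zsum (fun k => C0_mul (a k) (C0_autz h k (b (n - k))))) \in ell1_pred.
Proof.
apply/ell1_predP.
apply: (@le_lt_trans _ _ (ell1norm a * ell1norm b)%:E); last exact: ltry.
apply: (@le_trans _ _ (\esum_(n in [set: int]) \esum_(k in [set: int])
    (supnorm (a k) * supnorm (b (n - k)))%:E)%E).
  apply: le_esum => n _; apply: le_trans (zsum_supnorm _) _.
  apply: le_esum => k _; rewrite lee_fin; apply: le_trans (supnormM _ _) _.
  by rewrite ler_wpM2l ?supnorm_ge0 ?supnorm_autz.
have ge0 n k : (0 <= (supnorm (a k) * supnorm (b (n - k)))%:E)%E.
  by rewrite lee_fin mulr_ge0 ?supnorm_ge0.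
rewrite esum_esum//.
rewrite (@reindex_esum _ _ _ ([set: int] `*`` (fun=> [set: int])) _
          (fun p : int * int => (p.2, p.1))); last first.
  by split => [[x y]|[x y] [x' y'] _ _ [-> ->]|[x y] _] //; exists (y, x).
rewrite -(esum_esum (I := [set: int]) (J := fun=> [set: int])
  (a := fun k n => (supnorm (a k) * supnorm (b (n - k)))%:E))//.
rewrite (eq_esum (b := fun k => (ell1norm b * supnorm (a k))%:E)) => [|k _].
  rewrite esum_mull => [|//|k]; last exact: supnorm_ge0.
    by rewrite -ell1normE -EFinM mulrC.
  by rewrite -lee_fin ell1normE esum_supnorm_ge0.
rewrite esum_mull => [|//|n]; rewrite ?supnorm_ge0//.
rewrite mulrC EFinM ell1normE; congr (_ * _)%E.
rewrite [RHS](@reindex_esum _ _ _ [set: int] _ (fun n => n - k))//.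
by split => // [x y _ _ /addIr//|x _]; exists (x + k) => //; rewrite addrK.
Qed.

(* Twisted convolution: (a * b)_n = \sum_k a_k (C0_aut h)^k (b_(n - k)); it satisfies
   ell1_mul_delta below. *)
Definition ell1_mul (h : homeomorphism X) (a b : ell1) : ell1 :=
  MkEll1 (ell1_mul_subproof h a b).

Fact delta_subproof (f : C0X) (n : int) :
  (fun m => if m == n then f else 0) \in ell1_pred.
Proof.
apply/ell1_predP.
rewrite (eq_esum (b := fun m => if m \in [set n] then (supnorm f)%:E else 0%E)).
  by rewrite -esum_mkcond esum_set1 ?lee_fin ?supnorm_ge0 ?ltry.
by move=> m _; rewrite in_set1; case: eqP => // _; rewrite supnorm0.
Qed.

(* The formal sum f delta^n with a single term. *)
Definition delta (f : C0X) (n : int) : ell1 := MkEll1 (delta_subproof f n).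

Lemma zsum_single (u : int -> C0X) (n : int) :
  (forall k, k != n -> u k = 0) -> zsum u = u n.
Proof.
move=> u0; apply: lim_near_cst => //; exists `|n|%N => // N /= nN.
have lt : (absz (n + N%:Z)%R < N.*2.+1)%N by lia.
rewrite (bigD1 (Ordinal lt))//= big1 ?addr0.
  by congr u; lia.
move=> i /eqP ni; apply: u0; apply/eqP => e; apply: ni; apply: val_inj => /=; lia.
Qed.

Lemma ell1_mul_delta (h : homeomorphism X) (f g : C0X) (n m : int) :
  ell1_mul h (delta f n) (delta g m) = delta (C0_mul f (C0_autz h n g)) (n + m).
Proof.
apply/val_inj/funext => p /=; rewrite (@zsum_single _ n) => [|k /negbTE ->].
  rewrite eqxx (can2_eq (subrK n) (addrK n)) addrC; case: eqP => // _.
  apply/val_inj/funext => x /=; suff -> : C0_autz h n (0 : C0X) = 0 by rewrite mulr0.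
  have z h' : C0_aut h' (0 : C0X) = 0 by exact: val_inj.
  have zi h' k : iter k (C0_aut h') (0 : C0X) = 0 by elim: k => //= k ->; rewrite z.
  by case: n => k; exact: zi.
by apply/val_inj/funext => x /=; rewrite mul0r.
Qed.

Definition fixed_points (h : homeomorphism X) : set X := [set x | h x = x].

(* By definite description: the value is the constant 0 if there is no such
   functional or more than one. *)
Definition point_functional (h : homeomorphism X) (x : X) (xi : R[i]) :
    ell1 -> R[i]^o :=
  xget (fun=> 0) (unique (fun mu : ell1 -> R[i]^o =>
    is_character (ell1_mul h) mu /\
    forall (n : int) (f : C0X), mu (delta f n) = f x * xi ^ n)).

Definition point_ideal (h : homeomorphism X) (x : X) (xi : R[i]) : set ell1 :=
  [set a | point_functional h x xi a = 0].

End Ell1.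

Record cstarAut (R : realType) (A : commCStarAlgType R) := CstarAut {
  caut_fun :> A -> A ;
  caut_inv : A -> A ;
  caut_linear : linear caut_fun ;
  cautM : forall a b, caut_fun (cmul a b) = cmul (caut_fun a) (caut_fun b) ;
  caut_star : forall a, caut_fun (cstar a) = cstar (caut_fun a) ;
  caut_funK : cancel caut_fun caut_inv ;
  caut_invK : cancel caut_inv caut_fun }.

Section InducedHomeomorphism.
Context (R : realType) (A : commCStarAlgType R).

Fact cstarAut_sym_linear (s : cstarAut A) : linear (caut_inv s).
Proof. by move=> z a b; apply: (can_inj (caut_funK s)); rewrite caut_linear !caut_invK. Qed.
Fact cstarAut_symM (s : cstarAut A) a b :
  caut_inv s (cmul a b) = cmul (caut_inv s a) (caut_inv s b).
Proof. by apply: (can_inj (caut_funK s)); rewrite cautM !caut_invK. Qed.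
Fact cstarAut_sym_star (s : cstarAut A) a :
  caut_inv s (cstar a) = cstar (caut_inv s a).
Proof. by apply: (can_inj (caut_funK s)); rewrite caut_star !caut_invK. Qed.
Definition cstarAut_sym (s : cstarAut A) : cstarAut A :=
  CstarAut (cstarAut_sym_linear s) (cstarAut_symM s) (cstarAut_sym_star s)
           (caut_invK s) (caut_funK s).

Fact spectrum_act_subproof (s : cstarAut A) (mu : spectrum A) :
  set_val mu \o caut_inv s \in spectrum A.
Proof.
have [ml mM [a a0]] := set_valP mu; apply/mem_set; split => /=.
- by move=> z x y /=; rewrite cstarAut_sym_linear; exact: ml.
- by move=> x y /=; rewrite cstarAut_symM; exact: mM.
- by exists (s a); rewrite /= caut_funK.
Qed.
Definition spectrum_act (s : cstarAut A) (mu : spectrum A) : spectrum A :=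
  SigSub (spectrum_act_subproof s mu).

Fact spectrum_act_continuous (s : cstarAut A) : continuous (spectrum_act s).
Proof.
apply: continuous_comp_initial => mu.
have FF : Filter ((set_val \o spectrum_act s) x @[x --> mu]).
  by apply: fmap_filter; exact: nbhs_filter.
apply/(@pointwise_cvgP A R[i]^o _ _ FF) => a.
pose val : spectrum A -> {ptws A -> R[i]^o} := set_val.
have cv : continuous val by exact: initial_continuous.
have cp : continuous (@proj A (fun=> R[i]^o) (caut_inv s a) \o val).
  move=> nu; apply: (@continuous_comp _ {ptws A -> R[i]^o} _ val); first exact: (cv nu).
  exact: proj_continuous.
exact: (cp mu).
Qed.

Fact spectrum_actK (s : cstarAut A) :
  cancel (spectrum_act s) (spectrum_act (cstarAut_sym s)).
Proof.
move=> mu; apply/val_inj/funext => a.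
exact: (congr1 (set_val mu) (caut_funK s a)).
Qed.
Fact spectrum_actVK (s : cstarAut A) :
  cancel (spectrum_act (cstarAut_sym s)) (spectrum_act s).
Proof.
move=> mu; apply/val_inj/funext => a.
exact: (congr1 (set_val mu) (caut_invK s a)).
Qed.

Definition spectrum_homeo (s : cstarAut A) : homeomorphism (spectrum A) :=
  Homeomorphism (spectrum_act_continuous (s := s))
    (spectrum_act_continuous (s := cstarAut_sym s))
    (spectrum_actK s) (spectrum_actVK s).
End InducedHomeomorphism.

(* Main.v *)
Require Import Defs.
From mathcomp Require Import all_boot all_order all_algebra.
From mathcomp Require Import complex.
From mathcomp Require Import all_classical all_reals.
From mathcomp Require Import function_spaces topology normedtype.
From mathcomp Require Import zify ring lra.
From mathcomp Require Import ereal sequences esum derive.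

Set Implicit Arguments.
Unset Strict Implicit.
Unset Printing Implicit Defensive.

Import Order.TTheory GRing.Theory Num.Theory.
Import numFieldNormedType.Exports.
Import Normc.

Local Open Scope classical_set_scope.
Local Open Scope ring_scope.
Local Open Scope complex_scope.

(** Why the theorem holds.

    Write E for the twisted convolution algebra. Every character mu of E is
    contractive, because an element a with norm below 1 has a quasi-inverse
    b = a + a b, which rules out mu a = 1 ([character_contractive]). Since finite
    sums of monomials are dense ([zsum_delta]), bounded linear maps on E are
    determined by their values on monomials ([eq_on_delta]); this single
    principle gives the associativity of the product, the multiplicativity of
    the functional a |-> \sum_n a_n(x) xi^n, and the uniqueness in the definition
    of I(x, xi).

    From right to left: for a fixed point x and a unimodular xi that functional
    is a character ([point_sum_character]). The kernel of a character of E is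
    closed, has codimension one and contains all commutators, whence it is
    maximal, modular, and contains the closed commutator ideal
    ([character_ker_maximal]).

    From left to right: let I be a maximal modular ideal that contains all
    commutators, with u an identity modulo I. Then E / I is a commutative field,
    and quasi-inverses show that u has distance at least 1 from I, so that the
    quotient seminorm p vanishes exactly on I. The Gelfand-Mazur theorem
    ([gelfand_mazur]) asserts that every b is congruent to a multiple of u. Its
    proof replaces contour integrals by averages over the fourth roots of unity.
    If the assertion failed for b, the resolvent
    r_l = (b - l u)^-1 would exist modulo I for all l, and
    r_(l+z) = r_l + z r_l r_(l+z). Iterating this four times and summing over
    z = i^k c yields a mean inequality for p (r_l) over four points with an error
    of order c^4 ([resolvent_mean]). The function p (r_l) + eps |l|^2 can then
    have no interior maximum, although p (r_l) tends to 0 at infinity; so r_0 is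
    in I ([pseudo_resolvent_vanishes]), which is absurd. Hence I is the kernel
    of a character mu ([maximal_modular_character]).

    It remains to determine mu. Its restriction to the coefficients of delta^0 is
    a nonzero character of C0(X), which is evaluation at a point x
    ([C0_character_eval]): otherwise finitely many elements of its kernel would
    have no common zero on a given compact set K, F being the sum of their squared
    moduli, and g / (1 + k F), which differs from g by an element of the kernel,
    would be uniformly small for large k. Comparing the products of monomials in
    both orders gives mu (f delta^n) = f(x) xi^n, f(h^-1 x) = f(x) for all f, and
    |xi| = 1 since all integer powers of xi are bounded ([character_delta]).
    Finally x is a fixed point because C0(X) separates the points of the spectrum
    X of A. This is where the Gelfand transforms enter: they vanish at infinity
    by the compactness of the sets where an element of A has modulus at least e
    ([eval_at_compact]). *)

(** * Real-valued norms, sequences and complex limits *)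

Section RealNorm.
Context {R : realType}.
Implicit Types V W : normedModType R[i].

(** The norm of a complex normed module is a nonnegative element of R[i]; its real
    part is definitionally the sup norm on C0 and the l1 norm on ell1. *)
Definition rnorm {V} (v : V) : R := complex.Re `|v|.

Lemma rnormE V (v : V) : `|v| = (rnorm v)%:C.
Proof. by rewrite /rnorm RRe_real// normr_real. Qed.

Lemma rnorm_ge0 V (v : V) : 0 <= rnorm v.
Proof. by rewrite -lecR -rnormE normr_ge0. Qed.

Lemma rnormD V (v w : V) : rnorm (v + w) <= rnorm v + rnorm w.
Proof. by have := ler_normD v w; rewrite !rnormE -rmorphD lecR. Qed.

Lemma rnormZ V z (v : V) : rnorm (z *: v) = normc z * rnorm v.
Proof. by apply: complexI; have := normrZ z v; rewrite !rnormE rmorphM. Qed.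

Lemma rnormB V (v w : V) : rnorm (v - w) = rnorm (w - v).
Proof. by rewrite /rnorm distrC. Qed.

Lemma rnorm0 V : rnorm (0 : V) = 0.
Proof. by rewrite /rnorm normr0. Qed.

Lemma rnorm_eq0 V (v : V) : rnorm v = 0 -> v = 0.
Proof. by move=> v0; apply/eqP; rewrite -normr_eq0 rnormE v0. Qed.

Lemma normc_gt0 (z : R[i]) : z != 0 -> 0 < normc z.
Proof.
move=> z0; rewrite lt_neqAle normc_ge0 andbT eq_sym; apply: contra z0 => /eqP h.
by apply/eqP; exact: eq0_normc.
Qed.

Lemma rnorm_le_eps V (v : V) : (forall e : R, 0 < e -> rnorm v <= e) -> v = 0.
Proof.
move=> h; apply: rnorm_eq0; apply/eqP; rewrite eq_le rnorm_ge0 andbT.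
by apply/ler_addgt0Pr => e e0; rewrite add0r h.
Qed.

Lemma rnorm_tri V (u v w : V) : rnorm (u - w) <= rnorm (u - v) + rnorm (v - w).
Proof. by rewrite -[u - w](subrKA v) rnormD. Qed.

Lemma complex_gt0_real (e : R[i]) : 0 < e -> exists2 r : R, 0 < r & e = r%:C.
Proof.
case: e => a b; rewrite ltcE /= => /andP[/eqP-> a0].
by exists a.
Qed.

Lemma cvg_rnormP (T : Type) (F : set_system T) (FF : Filter F) V (f : T -> V) (l : V) :
  f @ F --> l <-> forall e : R, 0 < e -> \forall t \near F, rnorm (l - f t) < e.
Proof.
split=> [/cvgrPdist_lt h e e0|h].
  have /h : 0 < e%:C :> R[i] by rewrite ltcR.
  by apply: filterS => t; rewrite rnormE ltcR.
apply/cvgrPdist_lt => _ /complex_gt0_real[e e0 ->].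
by apply: filterS (h e e0) => t; rewrite rnormE ltcR.
Qed.

Lemma seq_cvgP V (u : nat -> V) (l : V) :
  u @ \oo --> l <->
  forall e : R, 0 < e -> exists N, forall n, (N <= n)%N -> rnorm (l - u n) < e.
Proof.
split=> [/cvg_rnormP h e e0|h].
  by have [N _ hN] := h _ e0; exists N => n Nn; exact: hN.
by apply/cvg_rnormP => e /h[N hN]; exists N.
Qed.

Definition cauchy_seq V (u : nat -> V) := forall e : R, 0 < e ->
  exists N, forall m n, (N <= m)%N -> (N <= n)%N -> rnorm (u m - u n) < e.

Definition seq_complete V := forall u : nat -> V, cauchy_seq u -> cvgn u.

Lemma lim_rnorm_le V (u : nat -> V) (l v : V) (M : R) : u @ \oo --> l ->
  (exists N, forall n, (N <= n)%N -> rnorm (u n - v) <= M) -> rnorm (l - v) <= M.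
Proof.
move=> /seq_cvgP ul [N hN]; apply/ler_addgt0Pr => e e0.
have [N' hN'] := ul _ e0.
apply: le_trans (rnorm_tri _ (u (maxn N N')) _) _; rewrite addrC.
by apply: lerD; [exact/hN/leq_maxl|exact/ltW/hN'/leq_maxr].
Qed.

Lemma seq_limn V (u : nat -> V) (l : V) : u @ \oo --> l -> limn u = l.
Proof. by move=> /cvg_lim; apply; exact: norm_hausdorff. Qed.

Lemma completeNormedModule_seq_complete (V : completeNormedModType R[i]) :
  seq_complete V.
Proof.
move=> u cu; apply: cauchy_cvg; apply: cauchy_exP.
move=> eps /complex_gt0_real[e e0 epsE]; rewrite {eps}epsE.
have [N hN] := cu _ e0; exists (u N); exists N => //= n Nn.
by rewrite -ball_normE /ball_ /= rnormE ltcR hN.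
Qed.

Lemma normc_le_ReIm (z : R[i]) : normc z <= `|complex.Re z| + `|complex.Im z|.
Proof.
case: z => a b /=; have ab0 : 0 <= `|a| + `|b| by rewrite addr_ge0.
rewrite -[leRHS](ger0_norm ab0) -[leRHS]sqrtr_sqr ler_wsqrtr//.
by rewrite sqrrD !real_normK ?num_real// lerD2r lerDl mulrn_wge0// mulr_ge0.
Qed.

Lemma Re_le_normc (z : R[i]) : `|complex.Re z| <= normc z.
Proof. by rewrite -lecR; exact: normc_ge_Re. Qed.

Lemma Im_le_normc (z : R[i]) : `|complex.Im z| <= normc z.
Proof.
by case: z => a b /=; rewrite -[leLHS]sqrtr_sqr ler_wsqrtr// lerDr sqr_ge0.
Qed.

(** Real and imaginary parts of a Cauchy sequence are Cauchy. *)
Lemma complex_seq_complete : seq_complete (R[i]^o).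
Proof.
move=> u cu.
have rc (p : R[i] -> R) : (forall z w, `|p z - p w| <= normc (z - w)) ->
    exists l, forall e, 0 < e -> exists N, forall n, (N <= n)%N -> `|l - p (u n)| < e.
  move=> pn; have /cvg_ex[l /cvgrPdist_lt ul] : cvgn (p \o u).
    apply: cauchy_cvg; apply: cauchy_exP.
    move=> e e0.
    have [N hN] := cu _ e0; exists (p (u N)); exists N => //= n Nn.
    by rewrite -ball_normE /ball_ /=; apply: le_lt_trans (pn _ _) _; exact: hN.
  by exists l => e /ul[N _ hN]; exists N => n; exact: hN.
have [a ha] : exists l, forall e, 0 < e ->
    exists N, forall n, (N <= n)%N -> `|l - complex.Re (u n)| < e.
  by apply: rc => z w; rewrite -(raddfB (@complex.Re R)) Re_le_normc.
have [b hb] : exists l, forall e, 0 < e ->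
    exists N, forall n, (N <= n)%N -> `|l - complex.Im (u n)| < e.
  by apply: rc => z w; rewrite -(raddfB (@complex.Im R)) Im_le_normc.
apply/cvg_ex; exists (a +i* b); apply/seq_cvgP => e e0.
have [N hN] := ha _ (divr_gt0 e0 (ltr0Sn R 1)).
have [N' hN'] := hb _ (divr_gt0 e0 (ltr0Sn R 1)).
exists (maxn N N') => n; rewrite geq_max => /andP[/hN h1 /hN' h2].
apply: le_lt_trans (normc_le_ReIm _) _; rewrite (splitr e).
by case: (u n) h1 h2 => x y; exact: ltrD.
Qed.

End RealNorm.

(** * Symmetric sums over the integers *)

Section LinearFunctions.
Context {K : nzRingType} {V W : lmodType K}.

Lemma linear_add (L : V -> W) : linear L -> {morph L : a b / a + b}.
Proof. by move=> LL a b; have := LL 1 a b; rewrite !scale1r. Qed.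

Lemma linear_zero (L : V -> W) : linear L -> L 0 = 0.
Proof. by move=> /linear_add LD; apply: (addrI (L 0)); rewrite -LD !addr0. Qed.

Lemma linear_scale (L : V -> W) z a : linear L -> L (z *: a) = z *: L a.
Proof. by move=> LL; have := LL z a 0; rewrite !addr0 linear_zero// addr0. Qed.

Lemma linear_sub (L : V -> W) : linear L -> {morph L : a b / a - b}.
Proof.
move=> LL a b; rewrite linear_add// -(scaleN1r b).
by rewrite linear_scale// scaleN1r.
Qed.

End LinearFunctions.

Section SymmetricSums.

(** The partial sums whose limit is [zsum]. *)
Definition symsum {M : nmodType} (u : int -> M) (N : nat) : M :=
  \sum_(i < N.*2.+1) u (i%:Z - N%:Z).

Lemma symsumS (M : nmodType) (u : int -> M) N :
  symsum u N.+1 = symsum u N + u N.+1%:Z + u (- N.+1%:Z).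
Proof.
rewrite /symsum doubleS big_ord_recr big_ord_recl /= [RHS]addrAC.
congr (_ + _); last by congr u; lia.
rewrite addrC; congr (_ + _); last by congr u; lia.
by apply: eq_bigr => i _; congr u; rewrite /= /bump /=; lia.
Qed.

Lemma symsum0 (M : nmodType) (u : int -> M) : symsum u 0 = u 0.
Proof. by rewrite /symsum big_ord_recl big_ord0 addr0. Qed.

Context {R : realType}.

Lemma ler_symsum (u v : int -> R) N : (forall n, u n <= v n) -> symsum u N <= symsum v N.
Proof. by move=> uv; apply: ler_sum. Qed.

(** Every finite set of integers lies in some interval [-N, N], so bounds on
    symmetric partial sums and on unordered sums are interchangeable. *)
Lemma symsum_esumP (w : int -> R) (M : R) : (forall n, 0 <= w n) ->
  (forall N, symsum w N <= M) <-> (\esum_(n in [set: int]) (w n)%:E <= M%:E)%E.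
Proof.
move=> w0; pose D N : set int := [set i%:Z - N%:Z | i in `I_(N.*2.+1)].
have DN N : (\sum_(n \in D N) (w n)%:E)%E = (symsum w N)%:E.
  rewrite /D fsbig_image; last by move=> i j _ _ /addIr [].
  by rewrite -(fsbig_ord _ _ (fun i => (w (i%:Z - N%:Z))%:E)) sumEFin.
have finD N : finite_set (D N) by exact: finite_image.
split=> [h|h N].
  apply: ge_ereal_sup => _ [F [finF _] <-].
  have [N FN] : exists N, F `<=` D N.
    have /finite_seqP[s ->] := finF; exists (\max_(n <- s) `|n|)%N => n ns.
    have := @leq_bigmax_seq _ s xpredT (fun n : int => `|n|%N) n ns isT.
    move: (\max_(n <- s) _)%N => N nN.
    by exists (absz (n + N%:Z)) => /=; lia.
  rewrite (le_trans _ (_ : (symsum w N)%:E <= _)%E) ?lee_fin// -DN.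
  by apply: lee_fsum_nneg_subset => // [|n _]; [exact/subsetP|rewrite lee_fin].
by rewrite -lee_fin -DN; apply: le_trans h; apply: esum_ge; exists (D N).
Qed.

Context {V W : normedModType R[i]}.
Implicit Types u v : int -> V.

Definition abs_bounded {V : normedModType R[i]} (u : int -> V) (M : R) :=
  forall N, symsum (fun n => rnorm (u n)) N <= M.

Lemma symsum_rnorm_diff u m n : (m <= n)%N ->
  rnorm (symsum u n - symsum u m) <=
  symsum (fun k => rnorm (u k)) n - symsum (fun k => rnorm (u k)) m.
Proof.
elim: n => [|n IH]; first by rewrite leqn0 => /eqP->; rewrite !subrr rnorm0.
rewrite leq_eqVlt => /orP[/eqP->|]; first by rewrite !subrr rnorm0.
move=> /IH{}IH; rewrite !symsumS.
rewrite -(addrA (symsum u n)) (addrAC (symsum u n)).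
rewrite -(addrA (symsum (fun k => rnorm (u k)) n)) (addrAC (symsum (fun k => rnorm (u k)) n)).
apply: le_trans (rnormD _ _) _; apply: lerD => //.
exact: rnormD.
Qed.

Lemma symsum_rnorm_homo u : {homo symsum (fun k => rnorm (u k)) : m n / (m <= n)%N >-> m <= n}.
Proof.
by move=> m n mn; rewrite -subr_ge0; apply: le_trans (symsum_rnorm_diff u mn);
  exact: rnorm_ge0.
Qed.

(** Differences of partial sums are dominated by differences of the partial sums
    of the norms, which form a bounded nondecreasing sequence. *)
Lemma zsum_cvg u M : seq_complete V -> abs_bounded u M -> symsum u @ \oo --> zsum u.
Proof.
move=> cV uM; apply: cV => e e0.
pose P := symsum (fun k => rnorm (u k)).
have ndP : nondecreasing_seq P by exact: symsum_rnorm_homo.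
have /cvg_ex[l Pl] : cvgn P.
  by apply: nondecreasing_is_cvgn => //; exists M => _ [n _ <-]; exact: uM.
have Ple n : P n <= l.
  by rewrite -(cvg_lim _ Pl)//; apply: nondecreasing_cvgn_le => //; apply/cvg_ex; exists l.
have [N _ hN] : \forall n \near \oo, `|l - P n| < e by move/cvgrPdist_lt : Pl; apply.
have key m n : (N <= m)%N -> (m <= n)%N -> rnorm (symsum u n - symsum u m) < e.
  move=> Nm mn; apply: le_lt_trans (symsum_rnorm_diff _ mn) _.
  have := hN m Nm; rewrite /= ger0_norm ?subr_ge0//; apply: le_lt_trans.
  by rewrite lerD2r.
exists N => m n Nm Nn; have [mn|/ltnW nm] := leqP m n.
  by rewrite rnormB key.
exact: key.
Qed.

Lemma zsum_unique (U : normedModType R[i]) (x : int -> U) l : symsum x @ \oo --> l -> zsum x = l.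
Proof. exact: seq_limn. Qed.

Lemma rnorm_zsum u M : seq_complete V -> abs_bounded u M -> rnorm (zsum u) <= M.
Proof.
move=> cV uM; rewrite -[zsum u]subr0; apply: lim_rnorm_le (zsum_cvg cV uM) _.
exists 0%N => n _; rewrite subr0; apply: le_trans (uM n).
rewrite /symsum; elim/big_ind2 : _ => // [|x a y b xa yb]; first by rewrite rnorm0.
by apply: le_trans (rnormD _ _) _; exact: lerD.
Qed.

Lemma zsum_linear u v M M' z : seq_complete V -> abs_bounded u M -> abs_bounded v M' ->
  zsum (fun n => z *: u n + v n) = z *: zsum u + zsum v.
Proof.
move=> cV uM vM; apply: zsum_unique.
rewrite (_ : symsum _ = (fun N => z *: symsum u N + symsum v N)).
  by apply: cvgD; [apply: cvgZr; exact: zsum_cvg uM|exact: zsum_cvg vM].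
by apply/funext => N; rewrite /symsum scaler_sumr -big_split.
Qed.

Definition lbounded {V W : normedModType R[i]} (L : V -> W) :=
  exists2 C : R, 0 <= C & forall a : V, rnorm (L a) <= C * rnorm a.

Lemma lbounded_cvg (L : V -> W) (w : nat -> V) l : linear L -> lbounded L ->
  w @ \oo --> l -> L \o w @ \oo --> L l.
Proof.
move=> LL [C C0 LC] /seq_cvgP ul; apply/seq_cvgP => e e0.
have C1 : 0 < C + 1 by rewrite ltr_wpDl.
have [N hN] := ul _ (divr_gt0 e0 C1); exists N => n /hN.
rewrite ltr_pdivlMr// => h; rewrite /= -linear_sub//.
apply: le_lt_trans (LC _) (le_lt_trans _ h).
by rewrite mulrC ler_wpM2l ?rnorm_ge0// lerDl.
Qed.

Lemma zsum_map (L : V -> W) u M : linear L -> lbounded L ->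
  seq_complete V -> abs_bounded u M -> zsum (L \o u) = L (zsum u).
Proof.
move=> LL LC cV uM; apply: zsum_unique.
rewrite (_ : symsum (L \o u) = L \o symsum u).
  exact: lbounded_cvg (zsum_cvg cV uM).
apply/funext => N; rewrite /symsum /=.
by rewrite (big_morph L (linear_add LL) (linear_zero LL)).
Qed.

End SymmetricSums.

(** * Completeness, and density of the monomials *)

Section Completeness.
Context {R : realType} {X : topologicalType}.
Local Notation C0X := (C0 R X).
Local Notation E := (ell1 R X).

Lemma C0_rnormE (f : C0X) : rnorm f = supnorm f. Proof. by []. Qed.

(** Completeness of C0 makes [zsum], and with it the twisted convolution, a true
    sum for absolutely summable families. *)
Lemma C0_seq_complete : seq_complete C0X.
Proof.
move=> f cf.
pose g x : R[i]^o := limn (fun k => f k x : R[i]^o).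
have gx x : (fun k => f k x : R[i]^o) @ \oo --> g x.
  apply: complex_seq_complete => e /cf[N hN]; exists N => m n Nm Nn.
  by apply: le_lt_trans (hN m n Nm Nn); exact: (supnorm_ub (f m - f n) x).
have unif (e : R) : 0 < e -> exists N, forall n, (N <= n)%N -> forall x,
    normc (g x - f n x) <= e.
  move=> /cf[N hN]; exists N => n Nn x; apply: lim_rnorm_le (gx x) _.
  exists N => m Nm; apply/ltW; apply: le_lt_trans (hN m n Nm Nn).
  exact: (supnorm_ub (f m - f n) x).
(* The uniform limit is continuous and small off a compact set. *)
have gC : g \in @C0_pred R X.
  apply/C0_predP; split.
    move=> x; have xF : Filter (nbhs x) by exact: nbhs_filter.
    apply/cvg_rnormP => e e0.
    have e3 : 0 < e / 3 by rewrite divr_gt0.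
    have [N /(_ N (leqnn N)) hN] := unif _ e3.
    have /C0_predP[/(_ x)/cvg_rnormP/(_ _ e3) cN _] := C0_valP (f N).
    apply: filterS cN => y fxy.
    have := @rnorm_tri R R[i]^o (g x) (f N x) (g y).
    have := @rnorm_tri R R[i]^o (f N x) (f N y) (g y).
    have h1 : @rnorm R R[i]^o (g x - f N x) <= e / 3 := hN x.
    have h2 : @rnorm R R[i]^o (f N y - g y) <= e / 3 by rewrite rnormB; exact: hN.
    have h3 : @rnorm R R[i]^o (f N x - f N y) < e / 3 := fxy.
    move: h1 h2 h3; set p := rnorm _; set q := rnorm _; set r := rnorm _.
    by set s := rnorm _; set t := rnorm _; lra.
  move=> e e0; have e2 : 0 < e / 2 by rewrite divr_gt0.
  have [N /(_ N (leqnn N)) hN] := unif _ e2.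
  have /C0_predP[_ /(_ _ e2)[K cK hK]] := C0_valP (f N).
  exists K => // x /hK fx; rewrite -[g x](subrK (f N x)) (splitr e).
  by apply: le_lt_trans (le_normcD _ _) _; exact: ler_ltD.
apply/cvg_ex; exists (MkC0 gC); apply/seq_cvgP => e e0.
have [N hN] := unif _ (divr_gt0 e0 (ltr0Sn R 1)); exists N => n Nn.
apply: le_lt_trans (_ : e / 2 < e); last by rewrite ltr_pdivrMr// mulr_natr mulr2n ltrDl.
by apply: supnorm_le => [|x]; [rewrite divr_ge0// ltW|exact: hN].
Qed.

Lemma ell1_rnormE (a : E) : rnorm a = ell1norm a. Proof. by []. Qed.

Lemma ell1norm_leP (a : E) (M : R) :
  ell1norm a <= M <-> abs_bounded (coef a) M.
Proof.
by rewrite -lee_fin ell1normE; split=> /symsum_esumP; apply=> n; exact: supnorm_ge0.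
Qed.

Lemma abs_bounded_ell1 (c : int -> C0X) M : abs_bounded c M -> c \in @ell1_pred R X.
Proof.
move=> cM; apply/ell1_predP; apply: le_lt_trans (ltry M).
by apply/symsum_esumP => // n; exact: supnorm_ge0.
Qed.

Lemma supnorm_coef (a : E) n : supnorm (a n) <= ell1norm a.
Proof.
rewrite -lee_fin ell1normE; apply: esum_ge; exists [set n]; first by split.
by rewrite fsbig_set1.
Qed.

Lemma symsum_small (w : nat -> int -> R) :
  (forall n (e : R), 0 < e -> exists N, forall m, (N <= m)%N -> w m n < e) ->
  forall M (e : R), 0 < e -> exists N, forall m, (N <= m)%N -> symsum (w m) M < e.
Proof.
move=> w0; elim=> [|M IH] e e0.
  by have [N hN] := w0 0 e e0; exists N => m /hN; rewrite symsum0.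
have e3 : 0 < e / 3 by rewrite divr_gt0.
have [N1 h1] := IH _ e3.
have [N2 h2] := w0 M.+1%:Z _ e3.
have [N3 h3] := w0 (- M.+1%:Z) _ e3.
exists (maxn N1 (maxn N2 N3)) => m; rewrite !geq_max => /and3P[/h1 ? /h2 ? /h3 ?].
by rewrite symsumS; lra.
Qed.

(** The limit is taken coefficient by coefficient. *)
Lemma ell1_seq_complete : seq_complete E.
Proof.
move=> a ca.
pose c n : C0X := limn (fun k => a k n).
have cn n : (fun k => a k n) @ \oo --> c n.
  apply: C0_seq_complete => e /ca[N hN]; exists N => m k Nm Nk.
  by apply: le_lt_trans (hN m k Nm Nk); exact: (supnorm_coef (a m - a k) n).
(* Only finitely many coefficients enter a symmetric partial sum, so the
   coefficientwise convergence can be used inside it; the bound e does not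
   depend on the partial sum. *)
have unif (e : R) : 0 < e -> exists N, forall k, (N <= k)%N ->
    abs_bounded (fun n => c n - a k n) e.
  move=> /ca[N hN]; exists N => k Nk M; apply/ler_addgt0Pr => d d0.
  have [N' hN'] : exists N', forall m, (N' <= m)%N ->
      symsum (fun n => rnorm (c n - a m n)) M < d.
    by apply: symsum_small d0 => n; apply/seq_cvgP; exact: cn.
  pose m := maxn N N'.
  have /ltW/ell1norm_leP/(_ M) h1 := hN m k (leq_maxl _ _) Nk.
  have /ltW h2 := hN' m (leq_maxr _ _).
  rewrite addrC; apply: le_trans (lerD h2 h1); rewrite /symsum -big_split.
  by apply: ler_sum => i _; exact: rnorm_tri.
have cE : c \in @ell1_pred R X.
  have [N /(_ N (leqnn N)) hN] := unif 1 ltr01.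
  apply: (@abs_bounded_ell1 _ (1 + ell1norm (a N))) => M.
  have /ell1norm_leP/(_ M) h1 := lexx (ell1norm (a N)).
  apply: le_trans (lerD (hN M) h1); rewrite /symsum -big_split.
  apply: ler_sum => i _; rewrite /=; set n := (_ - _ : int).
  by rewrite -[X in rnorm X <= _](subrK (a N n)); exact: rnormD.
apply/cvg_ex; exists (MkEll1 cE); apply/seq_cvgP => e e0.
have [N hN] := unif _ (divr_gt0 e0 (ltr0Sn R 1)); exists N => k Nk.
apply: le_lt_trans (_ : e / 2 < e); last by rewrite ltr_pdivrMr// mulr_natr mulr2n ltrDl.
by apply/ell1norm_leP; exact: hN.
Qed.

Lemma ell1norm_delta (f : C0X) n : ell1norm (delta f n) = supnorm f.
Proof.
apply: EFin_inj; rewrite ell1normE.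
rewrite (eq_esum (b := fun m => if m \in [set n] then (supnorm f)%:E else 0%E)).
  by rewrite -esum_mkcond esum_set1 ?lee_fin ?supnorm_ge0.
by move=> m _; rewrite in_set1 /=; case: eqP => // _; rewrite supnorm0.
Qed.

Lemma delta_abs_bounded (a : E) : abs_bounded (fun n => delta (a n) n) (ell1norm a).
Proof.
move=> N; have /ell1norm_leP/(_ N) := lexx (ell1norm a); apply: le_trans.
by apply: ler_symsum => n; rewrite ell1_rnormE ell1norm_delta.
Qed.

(** The family of monomials is absolutely summable in ell1, so its sum exists by
    completeness, and the bounded coefficient maps identify that sum with a. *)
Lemma zsum_delta (a : E) : zsum (fun n => delta (a n) n) = a.
Proof.
apply/val_inj/funext => m /=.
rewrite -(zsum_map (L := fun b : E => b m) _ _ ell1_seq_complete (delta_abs_bounded a)) //.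
- rewrite (@zsum_single _ _ _ m) => [|k km] /=; first by rewrite eqxx.
  by rewrite eq_sym (negbTE km).
- by exists 1 => // b; rewrite mul1r; exact: supnorm_coef.
Qed.

(** Density of the finite sums of monomials, in the form in which it is used. *)
Lemma eq_on_delta (W : normedModType R[i]) (L L' : E -> W) :
  linear L -> linear L' -> lbounded L -> lbounded L' ->
  (forall n f, L (delta f n) = L' (delta f n)) -> L =1 L'.
Proof.
move=> lL lL' bL bL' LL' a; rewrite -(zsum_delta a).
have db := delta_abs_bounded a.
rewrite -(zsum_map lL bL ell1_seq_complete db) -(zsum_map lL' bL' ell1_seq_complete db).
by congr zsum; apply/funext => n /=.
Qed.

End Completeness.

(** * The twisted convolution product *)

Section TwistedConvolution.
Context {R : realType} {X : topologicalType} (h : homeomorphism X).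
Local Notation C0X := (C0 R X).
Local Notation E := (ell1 R X).
Implicit Types (f g : C0X) (a b c : E) (n k : int).

(** The powers of the inverse homeomorphism, matching the action of [C0_autz] on
    functions by precomposition. *)
Definition homeo_pow (n : int) : X -> X :=
  match n with
  | Posz k => iter k (homeo_inv h)
  | Negz k => iter k.+1 h
  end.

Lemma C0_autzE n f x : C0_autz h n f x = f (homeo_pow n x).
Proof.
case: n => [k|k]; rewrite /C0_autz /homeo_pow.
  by elim: k x => // k IH x; rewrite iterS iterSr -IH.
by elim: k.+1 x => // {}k IH x; rewrite iterS iterSr -IH.
Qed.

Lemma homeo_powD n k x : homeo_pow n (homeo_pow k x) = homeo_pow (n + k) x.
Proof.
have inv_pow k' (y : X) : homeo_pow (k' + 1) y = homeo_inv h (homeo_pow k' y).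
  case: k' => [k'|[|k']].
  - by rewrite -PoszD addn1.
  - by rewrite /= homeo_funK.
  - have -> : Negz k'.+1 + 1 = Negz k' by lia.
    by rewrite [homeo_pow (Negz k'.+1) y]iterS homeo_funK.
have fun_pow k' (y : X) : homeo_pow (k' - 1) y = h (homeo_pow k' y).
  by rewrite -{2}(subrK 1 k') inv_pow homeo_invK.
elim/int_ind: n => [|n IH|n IH]; first by rewrite add0r.
  by rewrite intS addrC inv_pow IH -inv_pow; congr homeo_pow; lia.
by rewrite intS opprD addrC fun_pow IH -fun_pow; congr homeo_pow; lia.
Qed.

Lemma C0_ext f g : (forall x, f x = g x) -> f = g.
Proof. by move=> fg; apply/val_inj/funext. Qed.

Definition conv_term a b n : int -> C0X :=
  fun k => C0_mul (a k) (C0_autz h k (b (n - k))).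

Lemma conv_termE a b n k x :
  conv_term a b n k x = a k x * b (n - k) (homeo_pow k x).
Proof. by rewrite -(C0_autzE k (b (n - k)) x). Qed.

Lemma conv_term_bounded a b n :
  abs_bounded (conv_term a b n) (ell1norm a * ell1norm b).
Proof.
move=> N; have /ell1norm_leP/(_ N) ha := lexx (ell1norm a).
apply: le_trans (_ : symsum (fun k => rnorm (a k)) N * ell1norm b <= _); last first.
  by rewrite ler_wpM2r ?rnorm_ge0// -ell1_rnormE rnorm_ge0.
rewrite /symsum mulr_suml; apply: ler_sum => i _; rewrite C0_rnormE.
apply: le_trans (supnormM _ _) _; apply: ler_wpM2l; first exact: supnorm_ge0.
by apply: le_trans (supnorm_autz _ _ _) _; exact: supnorm_coef.
Qed.

Lemma ell1_mul_linearl b : linear (ell1_mul h ^~ b).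
Proof.
move=> z a a'; apply/val_inj/funext => n.
rewrite /= -[LHS]/(zsum (conv_term (z *: a + a') b n)).
rewrite -[RHS]/(z *: zsum (conv_term a b n) + zsum (conv_term a' b n)).
rewrite -(zsum_linear _ C0_seq_complete (conv_term_bounded a b n)
  (conv_term_bounded a' b n)).
congr zsum; apply/funext => k; apply: C0_ext => x /=.
by rewrite mulrDl -scalerAl.
Qed.

Lemma ell1_mul_linearr a : linear (ell1_mul h a).
Proof.
move=> z b b'; apply/val_inj/funext => n.
rewrite /= -[LHS]/(zsum (conv_term a (z *: b + b') n)).
rewrite -[RHS]/(z *: zsum (conv_term a b n) + zsum (conv_term a b' n)).
rewrite -(zsum_linear _ C0_seq_complete (conv_term_bounded a b n)
  (conv_term_bounded a b' n)).
congr zsum; apply/funext => k; apply: C0_ext => x; rewrite conv_termE.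
rewrite -[RHS]/(z * conv_term a b n k x + conv_term a b' n k x) !conv_termE.
by rewrite mulrCA -mulrDr.
Qed.

(** Submultiplicativity is the Tonelli theorem for the double sum of the products
    of the norms of coefficients. *)
Lemma ell1norm_mul a b : ell1norm (ell1_mul h a b) <= ell1norm a * ell1norm b.
Proof.
have na0 : 0 <= ell1norm a by exact: (rnorm_ge0 a).
have nb0 : 0 <= ell1norm b by exact: (rnorm_ge0 b).
have t0 n k : (0 <= (supnorm (a k) * supnorm (b (n - k)))%:E)%E.
  by rewrite lee_fin mulr_ge0 ?supnorm_ge0.
rewrite -lee_fin ell1normE.
apply: (@le_trans _ _ (\esum_(n in [set: int]) \esum_(k in [set: int])
    (supnorm (a k) * supnorm (b (n - k)))%:E)%E).
  apply: le_esum => n _; apply: le_trans (zsum_supnorm _) _.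
  apply: le_esum => k _; rewrite lee_fin; apply: le_trans (supnormM _ _) _.
  by rewrite ler_wpM2l ?supnorm_ge0 ?supnorm_autz.
rewrite esum_esum//.
(* Sum over k first, with m = n - k as the second index. *)
rewrite (@reindex_esum _ _ _ ([set: int] `*`` (fun=> [set: int])) _
          (fun p : int * int => (p.1 + p.2, p.1))); last first.
  split => [[x y]|[x y] [x' y'] _ _ [e e']|[x y] _] //.
    by move: e; rewrite e' => /(@addrI int) ->.
  by exists (y, x - y) => //=; rewrite addrC subrK.
rewrite -(esum_esum (I := [set: int]) (J := fun=> [set: int])
  (a := fun k m => (supnorm (a k) * supnorm (b (k + m - k)))%:E))//.
rewrite (eq_esum (b := fun k => (ell1norm b * supnorm (a k))%:E)) => [|k _].
  rewrite esum_mull => [|//|k]; last exact: supnorm_ge0.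
  by rewrite -ell1normE -EFinM mulrC.
rewrite (mulrC (ell1norm b)) EFinM ell1normE.
rewrite -esum_mull ?supnorm_ge0// => [|m]; last first.
  exact: supnorm_ge0.
by apply: eq_esum => m _; rewrite addrAC subrr add0r.
Qed.

Lemma ell1_mul_lboundedl b : lbounded (ell1_mul h ^~ b).
Proof.
by exists (ell1norm b) => [|a]; [exact: (rnorm_ge0 b)|rewrite mulrC; exact: ell1norm_mul].
Qed.

Lemma ell1_mul_lboundedr a : lbounded (ell1_mul h a).
Proof. by exists (ell1norm a) => [|b]; [exact: (rnorm_ge0 a)|exact: ell1norm_mul]. Qed.

Lemma linear_comp (U V W : lmodType R[i]) (L : U -> V) (L' : V -> W) :
  linear L -> linear L' -> linear (L' \o L).
Proof. by move=> lL lL' z u v /=; rewrite lL lL'. Qed.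

Lemma lbounded_comp (U V W : normedModType R[i]) (L : U -> V) (L' : V -> W) :
  lbounded L -> lbounded L' -> lbounded (L' \o L).
Proof.
move=> [C C0 hC] [D D0 hD]; exists (D * C); first exact: mulr_ge0.
by move=> v; rewrite -mulrA; apply: le_trans (hD _) _; rewrite ler_wpM2l.
Qed.

(** Both sides are bounded and linear in each argument, so it is enough to compare
    them on monomials; the arguments are released one at a time. *)
Lemma ell1_mulA : associative (@ell1_mul R X h).
Proof.
have ll := ell1_mul_linearl; have lr := ell1_mul_linearr.
have bl := ell1_mul_lboundedl; have br := ell1_mul_lboundedr.
have step1 n m p f g (e : C0X) : ell1_mul h (delta f n) (ell1_mul h (delta g m) (delta e p)) =
    ell1_mul h (ell1_mul h (delta f n) (delta g m)) (delta e p).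
  rewrite !ell1_mul_delta addrA; congr delta; apply: C0_ext => x.
  rewrite -[LHS]/(f x * C0_autz h n (C0_mul g (C0_autz h m e)) x).
  rewrite -[RHS]/(f x * C0_autz h n g x * C0_autz h (n + m) e x).
  rewrite !C0_autzE -mulrA; congr (_ * (_ * _)).
  by rewrite C0_autzE homeo_powD addrC.
have step2 n m f g c : ell1_mul h (delta f n) (ell1_mul h (delta g m) c) =
    ell1_mul h (ell1_mul h (delta f n) (delta g m)) c.
  move: c; apply: (eq_on_delta (linear_comp (lr _) (lr _)) (lr _)
    (lbounded_comp (br _) (br _)) (br _)) => p e; exact: step1.
have step3 n f b c : ell1_mul h (delta f n) (ell1_mul h b c) =
    ell1_mul h (ell1_mul h (delta f n) b) c.
  move: b; apply: (eq_on_delta (linear_comp (ll _) (lr _)) (linear_comp (lr _) (ll _))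
    (lbounded_comp (bl _) (br _)) (lbounded_comp (br _) (bl _))) => m g; exact: step2.
move=> a b c; move: a.
apply: (eq_on_delta (ll _) (linear_comp (ll _) (ll _)) (bl _)
  (lbounded_comp (bl _) (bl _))) => n f; exact: step3.
Qed.

End TwistedConvolution.

(** * Quasi-inverses in complete normed algebras *)

Section BanachAlgebras.
Context {R : realType}.

Record normed_product {V : normedModType R[i]} (mul : V -> V -> V) : Prop :=
  NormedProduct {
    mul_linearl : forall b, linear (mul^~ b) ;
    mul_linearr : forall a, linear (mul a) ;
    mul_rnorm : forall a b, rnorm (mul a b) <= rnorm a * rnorm b }.

(** The map b |-> a + a b is a contraction. *)
Lemma quasi_inverse (V : normedModType R[i]) (mul : V -> V -> V) a :
  seq_complete V -> normed_product mul -> rnorm a < 1 -> exists b, b = a + mul a b.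
Proof.
move=> cV [_ lr nM] a1; set q := rnorm a in a1.
have q0 : 0 <= q by exact: rnorm_ge0.
(* T is a q-contraction, and B is the fixed point of t |-> q + q t, which
   bounds the orbit of 0. *)
pose T b := a + mul a b; pose B := q / (1 - q).
have q1 : 0 < 1 - q by rewrite subr_gt0.
have B0 : 0 <= B by rewrite divr_ge0// ltW.
have TB v w : rnorm (T v - T w) <= q * rnorm (v - w).
  rewrite /T opprD addrACA subrr add0r -(linear_sub (lr a)); exact: nM.
have uB n : rnorm (iter n T 0) <= B.
  elim: n => [|n IH]; first by rewrite rnorm0.
  rewrite iterS; apply: le_trans (rnormD _ _) _.
  apply: le_trans (lerD (lexx _) (nM _ _)) _; rewrite -/q.
  apply: (@le_trans _ _ (q + q * B)); first by rewrite lerD2l ler_wpM2l.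
  suff -> : q + q * B = B by [].
  by rewrite /B; field; exact: lt0r_neq0.
have uD n k : rnorm (iter (n + k) T 0 - iter n T 0) <= q ^+ n * B.
  elim: n => [|n IH]; first by rewrite add0n subr0 expr0 mul1r uB.
  rewrite addSn !iterS exprS -mulrA; apply: le_trans (TB _ _) _.
  by rewrite ler_wpM2l.
have qn (e : R) : 0 < e -> exists N, q ^+ N * B < e.
  move=> e0; have B1 : 0 < B + 1 by rewrite ltr_wpDl.
  have : (fun n => q ^+ n) @ \oo --> (0 : R) by apply: cvg_expr; rewrite ger0_norm.
  move=> /cvgrPdist_lt/(_ _ (divr_gt0 e0 B1))[N _ /(_ N (leqnn N))] /=.
  rewrite sub0r normrN ger0_norm ?exprn_ge0// ltr_pdivlMr// => h; exists N.
  by apply: le_lt_trans h; rewrite ler_wpM2l ?exprn_ge0// lerDl.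
have /cvg_ex[l /= /seq_cvgP ul] : cvgn (fun n => iter n T 0).
  apply: cV => e e0; have [N hN] := qn _ (divr_gt0 e0 (ltr0Sn R 1)).
  exists N => m n /subnKC <- /subnKC <-.
  apply: le_lt_trans (rnorm_tri _ (iter N T 0) _) _; rewrite (splitr e).
  rewrite [X in _ + X]rnormB.
  by apply: ltrD; apply: le_lt_trans (uD _ _) hN.
exists l; apply/eqP; rewrite -subr_eq0; apply/eqP; rewrite -/(T l).
apply: rnorm_le_eps => e e0.
have [N hN] := ul _ (divr_gt0 e0 (ltr0Sn R 1)).
apply: le_trans (rnorm_tri _ (iter N.+1 T 0) _) _; rewrite (splitr e).
apply: lerD; first by apply/ltW/hN; exact: leqnSn.
rewrite iterS; apply: le_trans (TB _ _) _.
apply: le_trans (_ : 1 * rnorm (iter N T 0 - l) <= _).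
  by rewrite ler_wpM2r ?rnorm_ge0// ltW.
by rewrite mul1r rnormB ltW// hN.
Qed.

(** If mu a exceeded the norm of a, one could rescale to mu a = 1 with a of norm
    below 1; a quasi-inverse b = a + a b would give mu b = 1 + mu b. *)
Lemma character_contractive (V : normedModType R[i]) (mul : V -> V -> V)
    (mu : V -> R[i]^o) a : seq_complete V -> normed_product mul ->
  linear mu -> (forall a b, mu (mul a b) = mu a * mu b) -> normc (mu a) <= rnorm a.
Proof.
move=> cV nV lmu muM; rewrite leNgt; apply/negP => amu.
have mua0 : mu a != 0.
  apply: contraTneq amu => ->; rewrite normc0 -leNgt; exact: rnorm_ge0.
have nmu0 : 0 < normc (mu a) by apply: le_lt_trans amu; exact: rnorm_ge0.
have [|b ab] := @quasi_inverse _ _ ((mu a)^-1 *: a) cV nV.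
  by rewrite rnormZ normcV mulrC ltr_pdivrMr// mul1r.
have mu1 : mu ((mu a)^-1 *: a) = 1 by rewrite linear_scale//; exact: mulVf.
have := congr1 mu ab; rewrite linear_add// muM mu1 mul1r => /eqP.
by rewrite -subr_eq0 opprD addrCA subrr addr0 oppr_eq0 oner_eq0.
Qed.

End BanachAlgebras.

(** * Pseudo-resolvents modulo a seminorm *)

Section PseudoResolvents.
Context {R : realType} {V : lmodType R[i]} (mul : V -> V -> V).

(** Meant for the seminorm of a quotient: an equation modulo the ideal reads as the
    vanishing of the seminorm of a difference. *)
Record algebra_seminorm (p : V -> R) : Prop := AlgebraSeminorm {
  seminorm_ge0 : forall a, 0 <= p a ;
  seminormD : forall a b, p (a + b) <= p a + p b ;
  seminormZ : forall z a, p (z *: a) <= normc z * p a ;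
  seminormM : forall a b, p (mul a b) <= p a * p b }.

Context (p : V -> R) (pS : algebra_seminorm p) (mullr : forall a, linear (mul a)).

Lemma seminorm0 : p 0 = 0.
Proof.
apply/eqP; rewrite eq_le seminorm_ge0// andbT.
by have := seminormZ pS 0 0; rewrite scale0r normc0 mul0r.
Qed.

Lemma seminormN a : p (- a) = p a.
Proof.
have le b : p (- b) <= p b.
  by have := seminormZ pS (-1) b; rewrite scaleN1r normcN normc1 mul1r.
by apply/eqP; rewrite eq_le le -{1}[a]opprK le.
Qed.

Lemma seminorm_nullD a b : p b = 0 -> p (a + b) = p a.
Proof.
move=> b0; apply/eqP; rewrite eq_le.
have := seminormD pS a b; have := seminormD pS (a + b) (- b).
by rewrite addrK seminormN b0 !addr0 => -> ->.
Qed.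

Lemma seminorm_null2 a b : p a = 0 -> p b = 0 -> p (a + b) = 0.
Proof. by move=> a0 b0; rewrite seminorm_nullD. Qed.

Lemma seminorm_nullZ z a : p a = 0 -> p (z *: a) = 0.
Proof.
move=> a0; apply/eqP; rewrite eq_le seminorm_ge0// andbT.
by apply: le_trans (seminormZ pS _ _) _; rewrite a0 mulr0.
Qed.

Lemma seminorm_nullM a b : p b = 0 -> p (mul a b) = 0.
Proof.
move=> b0; apply/eqP; rewrite eq_le seminorm_ge0// andbT.
by apply: le_trans (seminormM pS _ _) _; rewrite b0 mulr0.
Qed.

Lemma seminorm_null_sum (I : finType) (F : I -> V) :
  (forall i, p (F i) = 0) -> p (\sum_i F i) = 0.
Proof.
move=> F0; elim/big_ind : _ => // [|a b]; [exact: seminorm0|exact: seminorm_null2].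
Qed.

Lemma seminorm_sum (I : finType) (F : I -> V) : p (\sum_i F i) <= \sum_i p (F i).
Proof.
elim/big_ind2 : _ => // [|a x b y ax by_]; first by rewrite seminorm0.
by apply: le_trans (seminormD pS _ _) _; exact: lerD.
Qed.

Lemma seminorm_eqD a b : p (a - b) = 0 -> p a = p b.
Proof. by move=> ab; rewrite -[in LHS](subrK b a) addrC seminorm_nullD. Qed.

Context (r : R[i] -> V).
Context (resolventE : forall l m, p (r l - r m - (l - m) *: mul (r m) (r l)) = 0).

Let T l (a : V) := mul (r l) a.

Lemma iter_mul_linear l n : linear (iter n (T l)).
Proof.
by elim: n => [|n IH] z a b //; rewrite !iterS IH; exact: mullr.
Qed.

Lemma seminorm_iter_mul l n a : p (iter n (T l) a) <= p (r l) ^+ n * p a.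
Proof.
elim: n => [|n IH]; first by rewrite expr0 mul1r.
rewrite iterS exprS -mulrA; apply: le_trans (seminormM pS _ _) _.
by rewrite ler_wpM2l ?seminorm_ge0.
Qed.

(** Iteration of the resolvent equation r_(l+z) = r_l + z r_l r_(l+z). *)
Lemma resolvent_taylor l z n :
  p (r (l + z) - (\sum_(i < n) z ^+ i *: iter i (T l) (r l) +
                  z ^+ n *: iter n (T l) (r (l + z)))) = 0.
Proof.
elim: n => [|n IH].
  by rewrite big_ord0 add0r expr0 scale1r subrr seminorm0.
set r' := r (l + z) in IH *; pose e := r' - r l - z *: mul (r l) r'.
have e0 : p e = 0 by have := resolventE (l + z) l; rewrite (_ : l + z - l = z) // addrAC subrr add0r.
rewrite big_ord_recr /=; set S := (\sum_(_ < _) _) in IH *.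
have -> : r' - (S + z ^+ n *: iter n (T l) (r l) + z ^+ n.+1 *: T l (iter n (T l) r')) =
    r' - (S + z ^+ n *: iter n (T l) r') + z ^+ n *: iter n (T l) e.
  have lT := @iter_mul_linear l n.
  rewrite /e !(linear_sub lT) (linear_scale _ _ lT) -[mul (r l) r']/(T l r').
  rewrite -iterSr !scalerBr scalerA -exprSr iterS.
  by rewrite !opprD !addrA subrK.
apply: seminorm_null2 => //; apply: seminorm_nullZ.
apply/eqP; rewrite eq_le seminorm_ge0// andbT.
by apply: le_trans (seminorm_iter_mul _ _ _) _; rewrite e0 mulr0.
Qed.

Lemma resolvent_dist_le l z :
  p (r (l + z) - r l) <= normc z * p (r l) * p (r (l + z)).
Proof.
rewrite (seminorm_eqD (b := z *: mul (r l) (r (l + z)))).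
  apply: le_trans (seminormZ pS _ _) _; rewrite -mulrA.
  by rewrite ler_wpM2l ?normc_ge0// (seminormM pS).
by have := resolventE (l + z) l; rewrite (_ : l + z - l = z) // addrAC subrr add0r.
Qed.

Lemma resolvent_local_bound l z : normc z * p (r l) <= 1 / 2 ->
  p (r (l + z)) <= 2 * p (r l).
Proof.
move=> zl; have := resolvent_dist_le l z; have := seminormD pS (r (l + z) - r l) (r l).
rewrite subrK; have := ler_wpM2r (seminorm_ge0 pS (r (l + z))) zl.
set u := p (r (l + z)); set x := p (r l); set t := normc z * x * u.
by set d := p _; lra.
Qed.

Lemma resolvent_dist l z : normc z * p (r l) <= 1 / 2 ->
  `|p (r (l + z)) - p (r l)| <= normc z * (2 * p (r l) ^+ 2).
Proof.
move=> zl; apply: le_trans (_ : p (r (l + z) - r l) <= _).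
  rewrite ler_norml; apply/andP; split.
    rewrite lerNl opprB lerBlDr -(seminormN (r (l + z) - r l)).
    by apply: le_trans (seminormD pS _ _); rewrite opprB subrK.
  by rewrite lerBlDr; apply: le_trans (seminormD pS _ _); rewrite subrK.
apply: le_trans (resolvent_dist_le _ _) _.
rewrite -mulrA ler_wpM2l ?normc_ge0//.
apply: le_trans (ler_wpM2l (seminorm_ge0 pS _) (resolvent_local_bound zl)) _.
by rewrite mulrCA expr2.
Qed.

Lemma resolvent_continuous : continuous (fun l : R[i]^o => p (r l) : R^o).
Proof.
move=> l; have lF : Filter (nbhs l) by exact: nbhs_filter.
apply/cvgrPdist_le => e e0; pose M := p (r l).
have M0 : 0 <= M by exact: seminorm_ge0.
have M1 : 0 < 2 * M + 1 by lra.
have N1 : 0 < 2 * M ^+ 2 + 1 by rewrite ltr_wpDl// mulr_ge0// exprn_ge0.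
have id_cvg : (fun m : R[i]^o => m) @ l --> l by exact: cvg_id.
have /cvg_rnormP h := id_cvg.
have d0 : 0 < Num.min (1 / (2 * M + 1)) (e / (2 * M ^+ 2 + 1)).
  by rewrite lt_min !divr_gt0.
apply: filterS (h _ d0) => m; rewrite rnormB -[rnorm _]/(normc (m - l)) lt_min.
rewrite ltr_pdivlMr// ltr_pdivlMr// => /andP[h1 h2].
have n0 := normc_ge0 (m - l).
rewrite distrC -{1}(subrK l m) [m - l + l]addrC; apply: le_trans (resolvent_dist _) _.
  by rewrite -/M; nra.
by rewrite -/M; nra.
Qed.

(** Orthogonality of the fourth roots of unity. *)
Lemma fourth_roots_sum (c : R[i]) (i : 'I_4) :
  \sum_(k < 4) ('i%C ^+ k * c) ^+ i = if i == 0 :> nat then 4 else 0.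
Proof.
have sqi : ('i%C : R[i]) ^+ 2 = -1 by exact: sqr_i.
move: ('i%C : R[i]) sqi => w sqi; rewrite !big_ord_recl big_ord0.
by case: i => [[|[|[|[|]]]]] //= _; ring: sqi.
Qed.

(** An approximate mean value inequality: the sums of the i-th powers of the fourth
    roots of unity vanish for i = 1, 2, 3, so the average of r over the four
    points l + i^k c differs from r_l by a term of order c^4. *)
Lemma resolvent_mean l (c : R) : 0 <= c -> c * p (r l) <= 1 / 2 ->
  4 * p (r l) <= \sum_(k < 4) p (r (l + 'i%C ^+ k * c%:C)) + c ^+ 4 * (8 * p (r l) ^+ 5).
Proof.
move=> c0 cl; pose z k : R[i] := 'i%C ^+ k * c%:C.
have nz k : normc (z k) = c.
  rewrite normcM /= expr0n addr0 sqrtr_sqr ger0_norm//.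
  suff -> : normc ('i%C ^+ k : R[i]) = 1 by rewrite mul1r.
  elim: k => [|k IH]; first by rewrite expr0 normc1.
  by rewrite exprS normcM IH mulr1 /= expr0n add0r expr1n sqrtr1.
pose D := \sum_(k < 4) r (l + z k) -
   c%:C ^+ 4 *: \sum_(k < 4) iter 4 (T l) (r (l + z k)).
(* Summing the four Taylor expansions of order 4 kills the powers 1, 2, 3. *)
have D4 : p (4 *: r l) = p D.
  apply/esym/seminorm_eqD.
  have := seminorm_null_sum (fun k : 'I_4 => resolvent_taylor l (z k) 4).
  rewrite sumrB big_split /= exchange_big /=.
  under [X in p (_ - (X + _))]eq_bigr do rewrite -scaler_suml fourth_roots_sum.
  rewrite [X in p (_ - (X + _))](bigD1 ord0)//= [X in _ + X + _]big1 ?addr0; last first.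
    by move=> i i0; rewrite ifN ?scale0r.
  rewrite opprD addrA => <-; rewrite /D addrAC; congr (p (_ - _)).
  congr (_ - _); rewrite scaler_sumr; apply: eq_bigr => k _; congr (_ *: _).
  rewrite /z exprMn -exprM mulnC exprM -[LHS]mul1r; congr (_ * _).
  have -> : ('i%C : R[i]) ^+ 4 = 1 by rewrite -[4%N]/(2 * 2)%N exprM sqr_i sqrrN expr1n.
  by rewrite expr1n.
(* Homogeneity of p is an inequality; applied to 4^-1 it gives the converse. *)
have h4 : 4 * p (r l) <= p (4 *: r l).
  have := seminormZ pS (4^-1) (4 *: r l).
  rewrite scalerA mulVf ?pnatr_eq0// scale1r normcV.
  have -> : normc (4 : R[i]) = 4 by rewrite -[4]/(4%:R) -mulr_natr mul1r normcMn normc1.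
  by rewrite ler_pdivlMl.
apply: le_trans h4 _; rewrite D4; apply: le_trans (seminormD pS _ _) _.
rewrite seminormN; apply: lerD; first exact: seminorm_sum.
apply: le_trans (seminormZ pS _ _) _.
have -> : normc (c%:C ^+ 4 : R[i]) = c ^+ 4.
  by rewrite -rmorphXn /= expr0n addr0 sqrtr_sqr ger0_norm// exprn_ge0.
rewrite ler_wpM2l ?exprn_ge0//; apply: le_trans (seminorm_sum _) _.
have -> : 8 * p (r l) ^+ 5 = \sum_(k < 4) (p (r l) ^+ 4 * (2 * p (r l))).
  by rewrite sumr_const card_ord; ring.
apply: ler_sum => k _; apply: le_trans (seminorm_iter_mul _ _ _) _.
by rewrite ler_wpM2l ?exprn_ge0 ?seminorm_ge0// resolvent_local_bound// nz.
Qed.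

End PseudoResolvents.

(** * A maximum principle for pseudo-resolvents *)

Section MaximumPrinciple.
Context {R : realType}.

Lemma complex_pair_continuous : continuous (fun q : R * R => (q.1 +i* q.2 : R[i]^o)).
Proof.
move=> q; have qF : Filter (nbhs q) by exact: nbhs_filter.
apply/cvg_rnormP => e e0; have e2 : 0 < e / 2 by rewrite divr_gt0.
have h1 : \forall t \near q, `|q.1 - t.1| < e / 2.
  by apply: (@cvgrPdist_lt _ _ _ (nbhs q) _ fst q.1).1 => //; exact: cvg_fst.
have h2 : \forall t \near q, `|q.2 - t.2| < e / 2.
  by apply: (@cvgrPdist_lt _ _ _ (nbhs q) _ snd q.2).1 => //; exact: cvg_snd.
apply: filterS2 h1 h2 => t t1 t2; apply: le_lt_trans (normc_le_ReIm _) _.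
by rewrite (splitr e); exact: ltrD.
Qed.

Lemma compact_square (M : R) :
  compact [set z : R[i]^o | `|complex.Re z| <= M /\ `|complex.Im z| <= M].
Proof.
have -> : [set z : R[i]^o | `|complex.Re z| <= M /\ `|complex.Im z| <= M] =
    (fun q : R * R => (q.1 +i* q.2 : R[i]^o)) @` (`[- M, M] `*` `[- M, M]).
  apply/seteqP; split => [[a b] /= [aM bM]|_ [[a b] /= [aM bM] <-]].
    by exists (a, b) => //; rewrite /= !in_itv /= -!ler_norml.
  by move: aM bM; rewrite !in_itv /= -!ler_norml.
apply: continuous_compact; last by apply: compact_setX; exact: segment_compact.
by apply: continuous_subspaceT; exact: complex_pair_continuous.
Qed.

(** A Liouville theorem. If p (r_0) = m > 0, then phi(z) = p (r_z) + eps |z|^2 has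
    on a large square a maximum in the interior, since p (r_z) is at most m / 2 on
    the boundary. At that point the four-point mean inequality for p (r_z), with
    error of order c^4, contradicts the gain eps c^2 of the quadratic term. *)
Lemma pseudo_resolvent_vanishes (V : lmodType R[i]) (mul : V -> V -> V)
    (p : V -> R) (r : R[i] -> V) :
  algebra_seminorm mul p -> (forall a, linear (mul a)) ->
  (forall l m, p (r l - r m - (l - m) *: mul (r m) (r l)) = 0) ->
  (forall e : R, 0 < e -> exists rho, forall l, rho <= normc l -> p (r l) <= e) ->
  p (r 0) = 0.
Proof.
move=> pS mullr rE decay; apply/eqP; apply: contraT => p0.
pose m := p (r 0).
have m0 : 0 < m by rewrite lt_neqAle eq_sym p0 (seminorm_ge0 pS).
have [rho0 h0] := decay _ (divr_gt0 m0 (ltr0Sn R 1)).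
pose rho := Num.max 1 rho0.
have rho1 : 1 <= rho by rewrite le_max lexx.
have hrho l : rho <= normc l -> p (r l) <= m / 2.
  by move=> lrho; apply: h0; apply: le_trans lrho; rewrite le_max lexx orbT.
have rho_gt0 : 0 < rho by exact: lt_le_trans rho1.
(* On the boundary of the square of half-side rho the penalty is at most
   2 eps rho^2 = m / 4, so that phi stays below 3 m / 4 there. *)
pose eps := m / (8 * rho ^+ 2).
have eps0 : 0 < eps by rewrite divr_gt0// mulr_gt0// exprn_gt0.
have epsE : eps * rho ^+ 2 = m / 8.
  by rewrite /eps; field; rewrite lt0r_neq0.
pose phi (z : R[i]^o) : R^o := p (r z) + eps * (complex.Re z ^+ 2 + complex.Im z ^+ 2).
pose K : set R[i]^o := [set z | `|complex.Re z| <= rho /\ `|complex.Im z| <= rho].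
have K0 : K 0 by split; rewrite /= normr0 ltW.
have ReIm_cvg (q : R[i] -> R) : (forall z w, `|q z - q w| <= normc (z - w)) ->
    continuous (fun z : R[i]^o => q z : R^o).
  move=> hq z; have zF : Filter (nbhs z) by exact: nbhs_filter.
  apply/cvgrPdist_lt => e e0.
  have id_cvg : (fun w : R[i]^o => w) @ z --> z by exact: cvg_id.
  have /cvg_rnormP/(_ e e0) := id_cvg.
  by apply: filterS => w; apply: le_lt_trans; exact: hq.
have cRe := ReIm_cvg (@complex.Re R)
  (fun z w => eq_ind _ (fun x => `|x| <= _) (Re_le_normc (z - w)) _ (raddfB _ _ _)).
have cIm := ReIm_cvg (@complex.Im R)
  (fun z w => eq_ind _ (fun x => `|x| <= _) (Im_le_normc (z - w)) _ (raddfB _ _ _)).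
have phi_cont : continuous phi.
  move=> z; have zF : Filter (nbhs (z : R[i]^o)) by exact: nbhs_filter.
  apply: cvgD; first exact: (resolvent_continuous pS rE).
  by apply: cvgMr; apply: cvgD; apply: cvgM; (exact: cRe || exact: cIm).
have [z /[!inE] -[zK1 zK2] zmax] := compact_EVT_max (ex_intro _ _ K0)
  (@compact_square rho) (continuous_subspaceT phi_cont).
have zmaxK w : K w -> phi w <= phi z by move=> Kw; apply: zmax; rewrite inE.
have phi0 : m <= phi z.
  have := zmaxK _ K0.
  by rewrite /phi -/m /= expr0n /= addr0 mulr0 addr0.
case: z zK1 zK2 zmax zmaxK phi0 => s t /= zK1 zK2 _ zmaxK phi0.
have sq_le (x : R) : `|x| <= rho -> x ^+ 2 <= rho ^+ 2.
  by move=> xr; rewrite -(real_normK (num_real x)) ler_sqr ?nnegrE// ltW.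
have inside : rho <= normc (s +i* t) -> False.
  move=> /hrho h; have := sq_le _ zK1; have := sq_le _ zK2.
  by move: phi0; rewrite /phi /= => h1 h2 h3; nra.
have s_lt : `|s| < rho.
  rewrite lt_neqAle zK1 andbT; apply/eqP => sr; apply: inside.
  by rewrite -sr; exact: (Re_le_normc (s +i* t)).
have t_lt : `|t| < rho.
  rewrite lt_neqAle zK2 andbT; apply/eqP => tr; apply: inside.
  by rewrite -tr; exact: (Im_le_normc (s +i* t)).
pose M := p (r (s +i* t)).
have M0 : 0 <= M by exact: (seminorm_ge0 pS).
have M5 : 0 <= M ^+ 5 by rewrite exprn_ge0.
(* The first two bounds keep the four points in the square, the third one is the
   hypothesis of the mean inequality, and the last one makes the quadratic gain
   4 eps c^2 exceed the error 8 c^4 M^5. *)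
pose c := Num.min (Num.min (rho - `|s|) (rho - `|t|))
  (Num.min (1 / (2 * M + 2)) (Num.min 1 (eps / (2 * M ^+ 5 + 1)))).
have c0 : 0 < c.
  rewrite !lt_min !subr_gt0 s_lt t_lt ltr01 /=.
  by apply/andP; split; apply: divr_gt0 => //; lra.
have : c <= c by [].
rewrite {2}/c !le_min => /andP[/andP[cs ct] /and3P[cM c1 ce]].
have cM' : c * M <= 1 / 2.
  by move: cM; rewrite ler_pdivlMr; [nra|lra].
have ce' : c * (2 * M ^+ 5 + 1) <= eps.
  by move: ce; rewrite ler_pdivlMr//; lra.
have := resolvent_mean pS mullr rE (ltW c0) cM'; rewrite -/M.
have point_le (x y : R) : `|x| + `|y| <= c -> p (r (s +i* t + (x +i* y))) <=
    phi (s +i* t) - eps * ((s + x) ^+ 2 + (t + y) ^+ 2).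
  move=> xy; rewrite lerBrDr; apply: (zmaxK ((s + x) +i* (t + y))).
  have := ler_normD s x; have := ler_normD t y; have := normr_ge0 x; have := normr_ge0 y.
  by split => /=; lra.
have c_n : `|c| = c by rewrite ger0_norm// ltW.
rewrite !big_ord_recl big_ord0 /=.
have -> : 'i%C ^+ 0 * c%:C = c +i* 0 :> R[i] by rewrite expr0 mul1r.
have -> : 'i%C ^+ bump 0 0 * c%:C = 0 +i* c :> R[i].
  by rewrite expr1; simpc; rewrite ?mulr0 ?mul0r ?addr0 ?subr0 ?mul1r.
have -> : 'i%C ^+ bump 0 (bump 0 0) * c%:C = (- c) +i* 0 :> R[i].
  by rewrite sqr_i mulN1r; apply/eqP; rewrite eq_complex /= oppr0 !eqxx.
have -> : 'i%C ^+ bump 0 (bump 0 (bump 0 0)) * c%:C = 0 +i* (- c) :> R[i].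
  rewrite exprS sqr_i; simpc.
  by rewrite ?mulr0 ?mul0r ?addr0 ?subr0 ?mul1r ?mulN1r ?oppr0 ?add0r.
have := point_le c 0; have := point_le 0 c.
have := point_le (- c) 0; have := point_le 0 (- c).
rewrite !normr0 !normrN c_n !addr0 !add0r.
move=> /(_ (lexx _)) h1 /(_ (lexx _)) h2 /(_ (lexx _)) h3 /(_ (lexx _)) h4.
have phiE : phi (s +i* t) = M + eps * (s ^+ 2 + t ^+ 2) by [].
rewrite phiE in h1 h2 h3 h4.
set p1 := p _ in h4 *; set p2 := p _ in h3 *; set p3 := p _ in h2 *; set p4 := p _ in h1 *.
move=> h.
have : 4 * eps * c ^+ 2 <= 8 * c ^+ 4 * M ^+ 5 by nra.
have c2 : 0 < c ^+ 2 by rewrite exprn_gt0.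
have -> : 8 * c ^+ 4 * M ^+ 5 = (8 * c ^+ 2 * M ^+ 5) * c ^+ 2 by ring.
rewrite ler_pM2r// => h'.
have : c ^+ 2 <= c by rewrite expr2; nra.
by nra.
Qed.

End MaximumPrinciple.

(** * Maximal modular ideals and the Gelfand-Mazur theorem *)

Section MaximalModularIdeals.
Context {R : realType} {V : normedModType R[i]} (mul : V -> V -> V).
Context (nP : normed_product mul) (mulA : associative mul).

Section QuotientSeminorm.
Context (I : set V) (idealI : is_ideal mul I).

Lemma ideal0 : I 0. Proof. by case: idealI. Qed.

Lemma idealD a b : I a -> I b -> I (a + b).
Proof. by case: idealI => _ /(_ 1 a b) + _ Ia Ib; rewrite scale1r; exact. Qed.

Lemma idealZ z a : I a -> I (z *: a).
Proof. by case: idealI => I0 /(_ z a 0) + _ Ia; rewrite addr0; exact. Qed.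

Lemma idealN a : I a -> I (- a).
Proof. by rewrite -scaleN1r; exact: idealZ. Qed.

Lemma idealB a b : I a -> I b -> I (a - b).
Proof. by move=> Ia Ib; apply: idealD => //; exact: idealN. Qed.

Lemma ideal_subl a b : I (a - b) -> I b -> I a.
Proof. by move=> ab Ib; rewrite -(subrK b a); exact: idealD. Qed.

Lemma ideal_subr a b : I (a - b) -> I a -> I b.
Proof. by rewrite -opprB => /idealN; rewrite opprK; exact: ideal_subl. Qed.

Lemma ideal_trans a b c : I (a - b) -> I (b - c) -> I (a - c).
Proof. by move=> ab bc; rewrite -(subrKA b); exact: idealD. Qed.

Lemma ideal_sym a b : I (a - b) -> I (b - a).
Proof. by move=> /idealN; rewrite opprB. Qed.

Lemma idealMl a b : I b -> I (mul a b).
Proof. by case: idealI => _ _ /(_ a b) h /h[]. Qed.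

Lemma idealMr a b : I b -> I (mul b a).
Proof. by case: idealI => _ _ /(_ a b) h /h[]. Qed.

Lemma ideal_congl a a' b : I (a - a') -> I (mul a b - mul a' b).
Proof. by rewrite -(linear_sub (mul_linearl nP b)); exact: idealMr. Qed.

Lemma ideal_congr a b b' : I (b - b') -> I (mul a b - mul a b').
Proof. by rewrite -(linear_sub (mul_linearr nP a)); exact: idealMl. Qed.

Definition quotient_seminorm (a : V) : R := inf [set rnorm (a - i) | i in I].

Lemma quotient_seminorm_le a i : I i -> quotient_seminorm a <= rnorm (a - i).
Proof.
move=> Ii; apply: ge_inf; last by exists i.
by exists 0 => _ [j _ <-]; exact: rnorm_ge0.
Qed.

Lemma quotient_seminorm_ge0 a : 0 <= quotient_seminorm a.
Proof.
apply: lb_le_inf; first by exists (rnorm (a - 0)), 0; first exact: ideal0.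
by move=> _ [j _ <-]; exact: rnorm_ge0.
Qed.

Lemma quotient_seminorm_approx a (e : R) : 0 < e ->
  exists2 i, I i & rnorm (a - i) < quotient_seminorm a + e.
Proof.
move=> e0; have hi : has_inf [set rnorm (a - i) | i in I].
  split; first by exists (rnorm (a - 0)), 0; first exact: ideal0.
  by exists 0 => _ [j _ <-]; exact: rnorm_ge0.
have [_ [i Ii <-] h] := inf_adherent e0 hi.
by exists i.
Qed.

Lemma quotient_seminormP : algebra_seminorm mul quotient_seminorm.
Proof.
split=> [a|a b|z a|a b].
- exact: quotient_seminorm_ge0.
- apply/ler_addgt0Pr => e e0; have e2 : 0 < e / 2 by rewrite divr_gt0.
  have [i Ii hi] := quotient_seminorm_approx a e2.
  have [j Ij hj] := quotient_seminorm_approx b e2.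
  apply: le_trans (quotient_seminorm_le _ (idealD Ii Ij)) _.
  by rewrite opprD addrACA; have := rnormD (a - i) (b - j); lra.
- have [->|z0] := eqVneq z 0.
    rewrite scale0r normc0 mul0r; apply: le_trans (quotient_seminorm_le _ ideal0) _.
    by rewrite subrr rnorm0.
  have nz := normc_gt0 z0.
  rewrite mulrC -ler_pdivrMr//; apply/ler_addgt0Pr => e e0.
  have [i Ii hi] := quotient_seminorm_approx a e0.
  rewrite ler_pdivrMr//; apply: le_trans (quotient_seminorm_le _ (idealZ z Ii)) _.
  by rewrite -scalerBr rnormZ mulrC ler_wpM2r// ltW.
- set s := quotient_seminorm a; set t := quotient_seminorm b.
  have s0 : 0 <= s by exact: quotient_seminorm_ge0.
  have t0 : 0 <= t by exact: quotient_seminorm_ge0.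
  apply/ler_addgt0Pr => e e0.
  (* (s + d) (t + d) <= s t + d (s + t + 1) because d <= 1. *)
  pose d := Num.min 1 (e / (s + t + 1)).
  have d0 : 0 < d by rewrite lt_min ltr01 divr_gt0//; lra.
  have : d <= d by [].
  rewrite {2}/d le_min => /andP[d1]; rewrite ler_pdivlMr; last by lra.
  move=> de; have [i Ii hi] := quotient_seminorm_approx a d0.
  have [j Ij hj] := quotient_seminorm_approx b d0.
  have Iij : I (mul a b - mul (a - i) (b - j)).
    apply: ideal_sym; apply: (@ideal_trans _ (mul a (b - j))).
      by apply: ideal_congl; rewrite addrAC subrr add0r; exact: idealN.
    by apply: ideal_congr; rewrite addrAC subrr add0r; exact: idealN.
  apply: le_trans (quotient_seminorm_le _ Iij) _; rewrite subKr.
  apply: le_trans (mul_rnorm nP _ _) _.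
  have := rnorm_ge0 (a - i); have := rnorm_ge0 (b - j).
  move: hi hj; rewrite -/s -/t; set x := rnorm _; set y := rnorm _ => hi hj y0 x0.
  apply: (@le_trans _ _ ((s + d) * (t + d))); last by nra.
  by apply: ler_pM => //; exact: ltW.
Qed.

Lemma quotient_seminorm_ideal a : I a -> quotient_seminorm a = 0.
Proof.
move=> Ia; apply/eqP; rewrite eq_le (seminorm_ge0 quotient_seminormP) andbT.
by apply: le_trans (quotient_seminorm_le _ Ia) _; rewrite subrr rnorm0.
Qed.

End QuotientSeminorm.

Context (cV : seq_complete V).
Context (I : set V) (maxI : is_maximal_ideal mul I).
Context (commI : forall a b, I (mul a b - mul b a)).
Context (u : V) (unitI : forall a, I (a - mul u a) /\ I (a - mul a u)).

Let idealI : is_ideal mul I. Proof. by case: maxI. Qed.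

(** An ideal that contains an identity modulo itself is everything. *)
Lemma modular_unit_notin : ~ I u.
Proof.
case: maxI => _ /eqP IT _ Iu; apply: IT; rewrite -subTset => a _.
by apply: (ideal_subl idealI (unitI a).1 _); exact: (idealMr idealI).
Qed.

(** If some i in I were at distance below 1 from u, a quasi-inverse b of u - i would
    satisfy b = u - i + u b = u + b modulo I, so that u would lie in I. *)
Lemma quotient_seminorm_unit : 1 <= quotient_seminorm I u.
Proof.
rewrite leNgt; apply/negP => u1.
have [|i Ii] := @quotient_seminorm_approx I idealI u (1 - quotient_seminorm I u).
  by rewrite subr_gt0.
rewrite (addrC (quotient_seminorm I u)) subrK => ui.
have [b bE] := quasi_inverse cV nP ui.
apply: modular_unit_notin; apply: (ideal_subl idealI _ Ii).
have -> : u - i = b - mul (u - i) b by rewrite {1}bE addrK.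
apply: (ideal_trans idealI (unitI b).1 _).
by apply: (ideal_congl idealI); rewrite subKr.
Qed.

(** The null space of the quotient seminorm is the closure of I, an ideal that
    does not contain u; by maximality it is I, which is therefore closed. *)
Lemma quotient_seminorm_eq0 a : quotient_seminorm I a = 0 -> I a.
Proof.
move=> a0; have pS := quotient_seminormP idealI.
case: maxI => _ _ /(_ [set x | quotient_seminorm I x = 0]) [||<-//|JT].
- split => /=; first by rewrite quotient_seminorm_ideal//; exact: (ideal0 idealI).
    move=> z x y x0 y0; apply: (seminorm_null2 pS) => //.
    exact: (seminorm_nullZ pS).
  move=> x y y0; split; first exact: (seminorm_nullM pS).
  apply/eqP; rewrite eq_le (seminorm_ge0 pS) andbT.
  by apply: le_trans (seminormM pS _ _) _; rewrite y0 mul0r.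
- by move=> x Ix /=; exact: quotient_seminorm_ideal.
- have := quotient_seminorm_unit.
  have -> : quotient_seminorm I u = 0.
    by have : [set: V] u by []; rewrite -JT.
  by rewrite ler10.
Qed.

(** Modulo I the multiples of c form an ideal that contains I and c. *)
Lemma maximal_inverse c : ~ I c -> exists d, I (mul c d - u).
Proof.
move=> Ic; pose J := [set x | exists d, I (x - mul c d)].
have cu : I (c - mul c u) by case: (unitI c).
case: maxI => _ _ /(_ J)[||JI|JT].
- split.
  + exists 0; rewrite (linear_zero (mul_linearr nP c)) subrr; exact: (ideal0 idealI).
  + move=> z x y [d hd] [e he]; exists (z *: d + e).
    rewrite (mul_linearr nP) opprD addrACA -scalerBr.
    by apply: (idealD idealI) => //; exact: (idealZ idealI).
  + move=> a b [d hd]; split.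
      exists (mul a d); apply: (ideal_trans idealI (ideal_congr idealI a hd) _).
      rewrite mulA [mul c (mul a d)]mulA; exact: (ideal_congl idealI).
    by exists (mul d a); rewrite mulA; exact: (ideal_congl idealI).
- move=> x Ix; exists 0; rewrite (linear_zero (mul_linearr nP c)) subr0//.
- by exfalso; apply: Ic; rewrite -JI; exists u.
- have [d hd] : J u by rewrite JT.
  by exists d; exact: (ideal_sym idealI).
Qed.

(** If no b - l u were in I, each would be invertible modulo I and the inverses
    would form a pseudo-resolvent that tends to 0 at infinity, hence vanishes at 0;
    but then u = b r_0 modulo I would be in I. *)
Lemma gelfand_mazur b : exists l : R[i], I (b - l *: u).
Proof.
apply: contrapT => /forallNP bI.
have /choice[r rE] l : exists d, I (mul (b - l *: u) d - u).
  by apply: maximal_inverse; exact: bI.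
have pS := quotient_seminormP idealI.
have ru l : I (mul u (r l) - r l) by apply: (ideal_sym idealI); case: (unitI (r l)).
have br l : I (mul b (r l) - (u + l *: r l)).
  have := rE l; rewrite (linear_sub (mul_linearl nP (r l))).
  rewrite (linear_scale _ _ (mul_linearl nP (r l))) => h.
  have := idealD idealI h (idealZ idealI l (ru l)).
  rewrite scalerBr !addrA; set L := l *: mul u _; set B := mul b _.
  by rewrite (addrAC _ (- u) L) subrK opprD addrA.
have r0 : quotient_seminorm I (r 0) = 0.
  apply: (pseudo_resolvent_vanishes pS (mul_linearr nP)).
    move=> l m; apply: quotient_seminorm_ideal => //.
    (* r l = r l (b - m u) r m and r m = r l (b - l u) r m modulo I. *)
    have h1 : I (r l - mul (r l) (mul (b - m *: u) (r m))).
      apply: (ideal_trans idealI (unitI (r l)).2 _).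
      by apply: (ideal_congr idealI); apply: (ideal_sym idealI).
    have h2 : I (r m - mul (r l) (mul (b - l *: u) (r m))).
      apply: (ideal_trans idealI (unitI (r m)).1 _).
      rewrite mulA; apply: (ideal_congl idealI).
      apply: (ideal_sym idealI); apply: (ideal_trans idealI (commI _ _) (rE l)).
    have h3 : I (mul (r l) (mul (b - m *: u) (r m)) - mul (r l) (mul (b - l *: u) (r m))
        - (l - m) *: mul (r m) (r l)).
      rewrite -(linear_sub (mul_linearr nP (r l))) -(linear_sub (mul_linearl nP (r m))).
      have -> : b - m *: u - (b - l *: u) = (l - m) *: u.
        by rewrite opprB addrC subrKA scalerBl.
      rewrite (linear_scale _ _ (mul_linearl nP (r m))).
      rewrite (linear_scale _ _ (mul_linearr nP (r l))) -scalerBr.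
      apply: (idealZ idealI).
      apply: (ideal_trans idealI _ (commI _ _)).
      exact: (ideal_congr idealI).
    have := idealD idealI (idealB idealI h1 h2) h3.
    rewrite addrA; congr (I (_ - _)).
    by rewrite opprB -addrA [X in _ + X]addrC subrKA subrKA.
  move=> e e0; have q0 := seminorm_ge0 pS.
  (* l r_l = b r_l - u modulo I bounds p (r_l) by p u / (normc l - p b). *)
  exists (quotient_seminorm I b + quotient_seminorm I u / e) => l hl.
  have := seminormD pS (l *: r l - mul b (r l)) (mul b (r l)); rewrite subrK.
  have -> : quotient_seminorm I (l *: r l - mul b (r l)) = quotient_seminorm I u.
    rewrite -(seminormN pS u); apply: (seminorm_eqD pS); rewrite opprK.
    apply: quotient_seminorm_ideal => //; have := idealN idealI (br l).
    by rewrite opprB (addrC u) addrAC.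
  have := seminormM pS b (r l).
  have : normc l * quotient_seminorm I (r l) <= quotient_seminorm I (l *: r l).
    have [->|l0] := eqVneq l 0; first by rewrite normc0 mul0r.
    have nl := normc_gt0 l0.
    have := seminormZ pS l^-1 (l *: r l); rewrite scalerA mulVf// scale1r normcV.
    by rewrite ler_pdivlMl.
  have u1 := quotient_seminorm_unit.
  set P := quotient_seminorm I (r l); set B := quotient_seminorm I b in hl *.
  set U := quotient_seminorm I u in hl u1 *; set N := normc l in hl *.
  move=> h1 h2 h3; have P0 : 0 <= P by exact: q0.
  have B0 : 0 <= B by exact: q0.
  have : (N - B) * P <= U by lra.
  have UN : U / e <= N - B by lra.
  move=> h; have : U / e * P <= U by apply: le_trans h; rewrite ler_wpM2r.
  rewrite mulrAC ler_pdivrMr// ler_pM2l//; lra.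
have : I u.
  have := br 0; rewrite scale0r addr0 => /(ideal_subr idealI); apply.
  by apply: (idealMl idealI); exact: quotient_seminorm_eq0.
exact: modular_unit_notin.
Qed.

(** The scalar that Gelfand-Mazur attaches to b depends linearly and
    multiplicatively on b because it is unique. *)
Lemma maximal_modular_character :
  exists2 mu : V -> R[i]^o, is_character mul mu & I = [set a | mu a = 0].
Proof.
have /choice[mu muE] := gelfand_mazur.
have uniq l m : I (l *: u - m *: u) -> l = m.
  rewrite -scalerBl => h; apply/eqP; rewrite -subr_eq0; apply/negPn/negP => lm.
  apply: modular_unit_notin; have := idealZ idealI (l - m)^-1 h.
  by rewrite scalerA mulVf// scale1r.
have muP a l : I (a - l *: u) -> mu a = l.
  move=> h; apply: uniq; apply: (ideal_trans idealI _ h).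
  exact: (ideal_sym idealI).
exists (mu : V -> R[i]^o); last first.
  apply/seteqP; split=> a /=.
    by move=> Ia; apply: muP; rewrite scale0r subr0.
  by move=> a0; have := muE a; rewrite a0 scale0r subr0.
split.
- move=> z a b; apply: muP.
  rewrite scalerDl -scalerA opprD addrACA -scalerBr.
  by apply: (idealD idealI) => //; exact: (idealZ idealI).
- move=> a b; apply: muP.
  apply: (ideal_trans idealI (ideal_congl idealI b (muE a)) _).
  apply: (ideal_trans idealI (ideal_congr idealI _ (muE b)) _).
  rewrite (linear_scale _ _ (mul_linearl nP _)) (linear_scale _ _ (mul_linearr nP _)).
  rewrite scalerA -scalerBr; apply: (idealZ idealI); apply: (ideal_sym idealI).
  by case: (unitI u).
- exists u; rewrite (muP u 1) ?oner_eq0// scale1r subrr; exact: (ideal0 idealI).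
Qed.

End MaximalModularIdeals.

(** * Characters of C0 of a space *)

Section FunctionalsOnC0.
Context {R : realType} {X : topologicalType}.
Local Notation C0X := (C0 R X).
Implicit Types (f g : C0X) (x : X).

(** A form of the finite cover property for a family S closed under addition, in
    which the finite sum replaces the finite subcover; X may be empty. *)
Lemma compact_cofinal (K : set X) (S : set (X -> R)) :
  compact K -> S !=set0 ->
  (forall r s, S r -> S s -> S (fun x => r x + s x)) ->
  (forall r, S r -> continuous (r : X -> R^o) /\ forall x, 0 <= r x) ->
  (forall x, K x -> exists2 r, S r & 1 < r x) ->
  exists2 r, S r & forall x, K x -> 1 <= r x.
Proof.
move=> /compact_near_coveringP cK [s0 Ss0] SD Sc SK.
(* The upper sets of S generate a filter because S is directed. *)
pose up (r : X -> R) := [set s | S s /\ forall x, r x <= s x].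
pose F : set_system (X -> R) := [set U | exists2 r, S r & up r `<=` U].
have FF : Filter F.
  split.
  - by exists s0.
  - move=> P Q [r Sr rP] [s Ss sQ]; exists (fun x => r x + s x); first exact: SD.
    move=> t [St rst]; split; [apply: rP|apply: sQ]; split=> // x;
      apply: le_trans (rst x).
      by rewrite lerDl; exact: (Sc _ Ss).2.
    by rewrite lerDr; exact: (Sc _ Sr).2.
  - by move=> P Q PQ [r Sr rP]; exists r => //; exact: subset_trans PQ.
have [x Kx|r Sr /(_ r) h] := cK _ F (fun r x => 1 <= r x) FF.
  have [r Sr r1] := SK x Kx.
  have near_r : \forall y \near x, 1 < r y.
    have [/(_ x)/cvgrPdist_lt/(_ (r x - 1)) + _] := Sc r Sr.
    rewrite subr_gt0 => /(_ r1); apply: filterS => y.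
    by rewrite ltr_norml => /andP[_]; rewrite ltrD2l ltrN2.
  exists ([set y | 1 < r y], up r) => //=; first by split=> //; exists r.
  by move=> [y s] /= [ry [_ rs]]; apply: ltW; exact: lt_le_trans (rs y).
by exists r => // x Kx; apply: h.
Qed.

Lemma normc_real (a : R) : normc a%:C = `|a|.
Proof. by rewrite /= expr0n /= addr0 sqrtr_sqr. Qed.

Lemma normcJ_eq (z : R[i]) : normc z^*%C = normc z.
Proof. by case: z => a b /=; rewrite sqrrN. Qed.

Lemma C0_continuous f : continuous f.
Proof. by have /C0_predP[] := C0_valP f. Qed.

Lemma C0_real_continuous f (r : X -> R) :
  (forall x, f x = (r x)%:C) -> continuous (r : X -> R^o).
Proof.
move=> fr x; have xF : Filter (nbhs x) by exact: nbhs_filter.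
apply/cvgrPdist_lt => d d0; have /cvg_rnormP/(_ d d0) := @C0_continuous f x.
by apply: filterS => y; rewrite !fr -rmorphB -[rnorm _]/(normc _) normc_real.
Qed.

Fact C0_scale_subproof (m : X -> R) (B : R) g : continuous (m : X -> R^o) ->
  (forall x, `|m x| <= B) -> (fun x => (m x)%:C * g x : R[i]^o) \in @C0_pred R X.
Proof.
move=> cm mB; have /C0_predP[cg vg] := C0_valP g; apply/C0_predP; split.
  move=> x; apply: (@cvgZ _ R[i]^o _ _ _ (fun y => (m y)%:C) g); last exact: cg.
  have xF : Filter (nbhs x) by exact: nbhs_filter.
  apply/(@cvg_rnormP R X _ xF R[i]^o) => e e0; have /cvgrPdist_lt/(_ e e0) := cm x.
  by apply: filterS => y; rewrite /rnorm -rmorphB [X in X -> _]/= => h;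
    rewrite -[complex.Re _]/(normc _) normc_real.
move=> e e0; have B1 : 0 < `|B| + 1 by rewrite ltr_wpDl.
have [K cK hK] := vg _ (divr_gt0 e0 B1); exists K => // x /hK.
rewrite ltr_pdivlMr// => h; rewrite normcM normc_real; apply: le_lt_trans h.
rewrite mulrC ler_wpM2l ?normc_ge0//; apply: le_trans (mB x) _.
by apply: le_trans (ler_norm B) _; rewrite lerDl.
Qed.

Fact C0_conj_subproof f : (fun x => (f x)^*%C : R[i]^o) \in @C0_pred R X.
Proof.
have /C0_predP[cf vf] := C0_valP f; apply/C0_predP; split.
  move=> x; have xF : Filter (nbhs x) by exact: nbhs_filter.
  apply/(@cvg_rnormP R X _ xF R[i]^o) => e e0.
  have /cvg_rnormP/(_ e e0) := cf x.
  by apply: filterS => y; rewrite -!/(normc _) -rmorphB /= => h;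
    rewrite -[rnorm _]/(normc _) normcJ_eq.
by move=> e /vf[K cK hK]; exists K => // x /hK; rewrite normcJ_eq.
Qed.

Definition C0_conj f : C0X := MkC0 (C0_conj_subproof f).

(** Stone-Weierstrass in the weak form needed here. The f such that L vanishes on
    f C0 form an ideal, and having no common zeros it contains some F >= 0 with
    F >= 1 on any given compact set. Then g - g / (1 + k F) = F (k g / (1 + k F))
    is killed by L, while g / (1 + k F) is uniformly small. *)
Lemma C0_functional_eq0 (L : C0X -> R[i]^o) : linear L -> lbounded L ->
  (forall x, exists2 f, (forall g, L (C0_mul f g) = 0) & f x != 0) ->
  forall g, L g = 0.
Proof.
move=> lL [C C0' hC] hx g.
suff small (e : R) : 0 < e -> normc (L g) <= C * e.
  apply: eq0_normc; apply/eqP; rewrite eq_le normc_ge0 andbT.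
  apply/ler_addgt0Pr => e e0; rewrite add0r.
  have C1 : 0 < C + 1 by lra.
  apply: le_trans (small _ (divr_gt0 e0 C1)) _.
  by rewrite mulrCA -[leRHS]mulr1 ler_pM2l// ler_pdivrMr// mul1r; lra.
move=> e0; have /C0_predP[_ /(_ e e0)[K cK hK]] := C0_valP g.
pose S := [set r : X -> R | exists F : C0X,
  [/\ forall g, L (C0_mul F g) = 0, forall x, F x = (r x)%:C & forall x, 0 <= r x]].
have [|||x Kx|r [F [LF Fr r0]] r1] := @compact_cofinal K S cK.
- exists (fun=> 0), 0; split=> // f; rewrite (_ : C0_mul 0 f = 0) ?(linear_zero lL)//.
    by apply: C0_ext => x; exact: mul0r.
- move=> r s [F [LF Fr r0]] [G [LG Gs s0]]; exists (F + G); split=> [f|x|x].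
  + rewrite (_ : C0_mul (F + G) f = C0_mul F f + C0_mul G f).
      by rewrite linear_add// LF LG addr0.
    by apply: C0_ext => x; exact: mulrDl.
  + by rewrite -[LHS]/(F x + G x) Fr Gs rmorphD.
  + exact: addr_ge0.
- by move=> r [F [LF Fr r0]]; split=> //; exact: C0_real_continuous Fr.
- have [f Lf fx] := hx x.
  have nf := normc_gt0 fx.
  (* The multiple of |f|^2 that takes the value 2 at x. *)
  pose t : R := 2 / normc (f x) ^+ 2.
  have t0 : 0 <= t by rewrite divr_ge0// exprn_ge0// ltW.
  exists (fun y => t * normc (f y) ^+ 2); last first.
    by rewrite /t divfK ?ltr1n// lt0r_neq0// exprn_gt0.
  exists (C0_mul f (t%:C *: C0_conj f)); split=> [h|y|y].
  + rewrite (_ : C0_mul _ h = C0_mul f (C0_mul (t%:C *: C0_conj f) h)) ?Lf//.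
    by apply: C0_ext => y; exact/esym/mulrA.
  + rewrite -[LHS]/(f y * (t%:C * (f y)^*%C)) mulrCA -sqr_normc.
    by rewrite -[`|_|]/((normc (f y))%:C) -rmorphXn -rmorphM.
  + by rewrite mulr_ge0// exprn_ge0 ?normc_ge0.
(* With k = |g| / e, the quotient g / (1 + k F) is at most e everywhere: on K
   because F >= 1 there, off K because g already is. *)
have k0 : 0 <= supnorm g / e by rewrite divr_ge0 ?supnorm_ge0 ?ltW.
set k := supnorm g / e in k0.
pose m x : R := (1 + k * r x)^-1.
have d1 x : 1 <= 1 + k * r x by rewrite lerDl mulr_ge0.
have d0 x : 0 < 1 + k * r x by exact: lt_le_trans (d1 x).
have m0 x : 0 <= m x by rewrite invr_ge0 ltW.
have m1 x : m x <= 1 by rewrite invf_le1.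
have cr := C0_real_continuous Fr.
have cm : continuous (m : X -> R^o).
  move=> x; apply: cvgV; first exact: lt0r_neq0.
  by apply: cvgD; [exact: cvg_cst|apply: cvgMr; exact: cr].
have mn x : `|m x| <= 1 by rewrite ger0_norm.
pose g' : C0X := MkC0 (C0_scale_subproof g cm mn).
have gE : g = C0_mul F (k%:C *: g') + g'.
  apply: C0_ext => x; rewrite -[RHS]/(F x * (k%:C * ((m x)%:C * g x)) + (m x)%:C * g x).
  rewrite Fr !mulrA -mulrDl -!rmorphM -rmorphD -[LHS]mul1r; congr (_ * _).
  rewrite -[LHS]/(1%:C); congr (_%:C); rewrite /m; field.
  by rewrite lt0r_neq0// addrC mulrC.
rewrite gE linear_add// LF add0r; apply: le_trans (hC g') _; rewrite ler_wpM2l//.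
apply: supnorm_le => [|x]; first exact: ltW.
rewrite normcM normc_real ger0_norm//; have [Kx|/hK/ltW h] := pselect (K x); last first.
  by apply: le_trans h; rewrite ler_piMl ?normc_ge0.
rewrite /m mulrC ler_pdivrMr//; apply: le_trans (supnorm_ub g x) _.
apply: (@le_trans _ _ (e * k)); first by rewrite /k mulrCA divff ?mulr1// lt0r_neq0.
apply: ler_wpM2l; first exact: ltW.
apply: (@le_trans _ _ (k * r x)).
  by rewrite ler_peMr ?r1.
by rewrite lerDr.
Qed.

Lemma C0_normed_product : normed_product (@C0_mul R X).
Proof.
split=> [g z f f'|f z g g'|f g].
- by apply: C0_ext => x; rewrite /= mulrDl -scalerAl.
- by apply: C0_ext => x; rewrite /= mulrDr -scalerAr.
- exact: supnormM.
Qed.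

(** If the elements of the kernel had no common zero, the character would vanish by
    [C0_functional_eq0]. At a common zero x, every f is phi f times one fixed
    function e with phi e = 1, and e^2 shows that e x = 1. *)
Lemma C0_character_eval (phi : C0X -> R[i]^o) : is_character (@C0_mul R X) phi ->
  (forall x, exists f, f x != 0) -> exists x, forall f, phi f = f x.
Proof.
move=> [lphi phiM [f0 f00]] sep.
have bphi : lbounded phi.
  exists 1 => // f; rewrite mul1r.
  exact: (character_contractive f C0_seq_complete C0_normed_product).
have [x hx] : exists x, forall f, phi f = 0 -> f x = 0.
  apply: contrapT => /forallNP h; move/eqP: f00; apply.
  apply: (C0_functional_eq0 lphi bphi) => x.
  have /existsNP[f /not_implyP[pf fx]] := h x.
  by exists f; [move=> g; rewrite phiM pf mul0r|exact/eqP].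
pose e : C0X := (phi f0)^-1 *: f0.
have e1 : phi e = 1 by rewrite linear_scale//; exact: mulVf.
have key f : f x = phi f * e x.
  have := hx (f - phi f *: e); rewrite linear_sub// linear_scale// e1.
  rewrite [_ *: _]mulr1 subrr => /(_ erefl) /eqP.
  by rewrite -[X in X == 0]/(f x - phi f * e x) subr_eq0 => /eqP.
have ex0 : e x != 0.
  by have [f] := sep x; apply: contra => /eqP h; rewrite key h mulr0.
have ex1 : e x = 1.
  have := key (C0_mul e e); rewrite phiM e1 mul1r mul1r -[LHS]/(e x * e x).
  by rewrite -[RHS]mul1r => /(mulIf ex0).
by exists x => f; rewrite key ex1 mulr1.
Qed.

End FunctionalsOnC0.

(** * The Gelfand transform *)

Section GelfandTransform.
Context {R : realType} (A : commCStarAlgType R).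
Implicit Types (a b c : A) (x : spectrum A).

Definition eval_at a x : R[i]^o := (set_val x : A -> R[i]^o) a.

Lemma eval_at_linear x : linear (eval_at^~ x).
Proof. by case: (set_valP x). Qed.

Lemma eval_atM x a b : eval_at (cmul a b) x = eval_at a x * eval_at b x.
Proof. by case: (set_valP x) => _ h _; exact: h. Qed.

Lemma eval_at_neq0 x : exists a, eval_at a x != 0.
Proof. by case: (set_valP x). Qed.

Lemma cstar_normed_product : normed_product (@cmul R A).
Proof.
split; first exact: cmul_linear.
  by move=> a z b c; rewrite !(cmulC a); exact: cmul_linear.
by move=> a b; have := cmul_norm a b; rewrite !rnormE -rmorphM lecR.
Qed.

Lemma eval_at_contractive a x : normc (eval_at a x) <= rnorm a.
Proof.
apply: (character_contractive (mul := @cmul R A) (mu := eval_at^~ x)).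
- exact: completeNormedModule_seq_complete.
- exact: cstar_normed_product.
- exact: eval_at_linear.
- exact: eval_atM.
Qed.

Lemma eval_at_continuous a : continuous (eval_at a).
Proof.
move=> x; pose val : spectrum A -> {ptws A -> R[i]^o} := set_val.
have cv : continuous val by exact: initial_continuous.
apply: (@continuous_comp _ {ptws A -> R[i]^o} _ val (@proj A (fun=> R[i]^o) a)).
  exact: cv.
exact: proj_continuous.
Qed.

(** A cluster point of the image of an ultrafilter is a limit, since each
    neighbourhood or its complement has its preimage in the ultrafilter. *)
Lemma ultra_cvg_compact (T : Type) (Y : topologicalType) (F : set_system T)
    (f : T -> Y) (K : set Y) : UltraFilter F -> compact K ->
  (\forall t \near F, K (f t)) -> exists2 y, K y & f @ F --> y.
Proof.
move=> FU cK FK; have FP : ProperFilter (f @ F).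
  by apply: fmap_proper_filter; exact: ultra_proper.
have [y [Ky cly]] := cK _ FP FK; exists y => // U yU.
have [//|FnU] := in_ultra_setVsetC (f @^-1` U) FU.
have [z [nUz Uz]] := cly (~` U) U FnU yU.
by [].
Qed.

(** Banach-Alaoglu: along an ultrafilter all evaluations converge, because each
    takes values in a bounded square. The pointwise limit is again multiplicative
    and linear, and the bound at a survives, so that the limit is not zero. *)
Lemma eval_at_compact a (e : R) : 0 < e ->
  compact [set x : spectrum A | e <= normc (eval_at a x)].
Proof.
move=> e0; rewrite compact_ultra => F FU FK.
have FP : ProperFilter F by exact: ultra_proper.
have /choice[phi phiE] b : exists z : R[i]^o, eval_at b @ F --> z.
  have [|z _ hz] := @ultra_cvg_compact _ _ F (eval_at b) _ FU (@compact_square R (rnorm b)).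
  - apply: filterE => x; split; apply: le_trans (eval_at_contractive b x).
      exact: Re_le_normc.
    exact: Im_le_normc.
  by exists z.
have uniq b z : eval_at b @ F --> z -> phi b = z.
  by move=> h; apply: cvg_unique (phiE b) h; exact: norm_hausdorff.
have phi_a : e <= normc (phi a).
  rewrite leNgt; apply/negP => h.
  have d0 : 0 < e - normc (phi a) by rewrite subr_gt0.
  have /cvg_rnormP/(_ _ d0) hF := phiE a.
  have [x [/= ex]] := filter_ex (filterI FK hF).
  rewrite -[rnorm _]/(normc (phi a - eval_at a x)) ltNge => /negP; apply.
  rewrite lerBlDr; apply: le_trans ex _; rewrite -[X in normc X <= _](subKr (phi a)).
  apply: le_trans (le_normcD _ _) _; rewrite normcN addrC //.
have phi_spec : (phi : {ptws A -> R[i]^o}) \in spectrum A.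
  apply/mem_set; split => /=.
  - move=> z b c; apply: uniq.
    rewrite (_ : eval_at _ = fun x => z *: eval_at b x + eval_at c x).
      by apply: cvgD; [apply: cvgZr; exact: phiE|exact: phiE].
    by apply/funext => x; exact: eval_at_linear.
  - move=> b c; apply: uniq.
    rewrite (_ : eval_at _ = fun x => eval_at b x * eval_at c x).
      by apply: (@cvgZ _ R[i]^o _ _ _ (eval_at b) (eval_at c)); exact: phiE.
    by apply/funext => x; exact: eval_atM.
  - exists a; apply: contraTneq phi_a => ->; by rewrite normc0 -ltNge.
pose y : spectrum A := SigSub phi_spec.
exists y; split => //=.
have ptws_cvg : {ptws, (set_val : spectrum A -> A -> R[i]^o) @ F --> (phi : A -> R[i]^o)}.
  by apply/pointwise_cvgP => b; exact: phiE.
move=> U [_ [[W oW <-]] /= Wy /filterS]; apply.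
by apply: ptws_cvg; exact: open_nbhs_nbhs.
Qed.

Fact gelfand_subproof a : eval_at a \in @C0_pred R (spectrum A).
Proof.
apply/C0_predP; split; first exact: eval_at_continuous.
move=> e e0; exists [set x | e <= normc (eval_at a x)]; first exact: eval_at_compact.
by move=> x /negP; rewrite -ltNge.
Qed.

Definition gelfand a : C0 R (spectrum A) := MkC0 (gelfand_subproof a).

Lemma spectrum_ext x y : (forall f : C0 R (spectrum A), f x = f y) -> x = y.
Proof. by move=> xy; apply/val_inj/funext => a; exact: (xy (gelfand a)). Qed.

Lemma C0_spectrum_neq0 x : exists f : C0 R (spectrum A), f x != 0.
Proof. by have [a ax] := eval_at_neq0 x; exists (gelfand a). Qed.

End GelfandTransform.

(** * Characters of the twisted convolution algebra *)

Section CharactersOfEll1.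
Context {R : realType} {X : topologicalType} (h : homeomorphism X).
Local Notation C0X := (C0 R X).
Local Notation E := (ell1 R X).
Local Notation mul := (@ell1_mul R X h).
Implicit Types (f g : C0X) (a b : E) (mu : E -> R[i]^o).

Lemma ell1_normed_product : normed_product mul.
Proof.
split; [exact: ell1_mul_linearl|exact: ell1_mul_linearr|exact: ell1norm_mul].
Qed.

Lemma character_lbounded mu : is_character mul mu -> lbounded mu.
Proof.
move=> [lmu muM _]; exists 1 => // a; rewrite mul1r.
exact: (character_contractive a ell1_seq_complete ell1_normed_product).
Qed.

Lemma delta_linear n : linear (fun f : C0X => delta f n).
Proof.
move=> z f g; apply/val_inj/funext => m /=.
rewrite -[RHS]/(z *: (if m == n then f else 0) + (if m == n then g else 0)).
by case: eqP => // _; rewrite scaler0 addr0.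
Qed.

(** With e x = 1 and c_n = mu (e delta^n), commutation with delta^0 gives
    mu (f delta^n) = f(x) c_n, and the product of e delta and f delta^n gives
    c_1 f(x) c_n = f(h^-1 x) c_(n+1). The cases n = -1 and n = 0 yield c_1 != 0
    and f(h^-1 x) = f(x), after which c_n = c_1^n. *)
Lemma character_delta mu : is_character mul mu ->
  (forall x : X, exists f, f x != 0) ->
  exists x (xi : R[i]), [/\ forall f, f (homeo_inv h x) = f x, normc xi = 1 &
    forall n f, mu (delta f n) = f x * xi ^ n].
Proof.
move=> cmu sep; have [lmu muM [a0 a00]] := cmu; have bmu := character_lbounded cmu.
pose F n f : R[i]^o := mu (delta f n).
have lF n : linear (F n) by exact: linear_comp (delta_linear n) lmu.
have bF n : lbounded (F n).
  case: bmu => C C0' hC; exists C => // f; apply: le_trans (hC _) _.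
  by rewrite ell1_rnormE ell1norm_delta.
have FM f g n m : F n f * F m g = F (n + m) (C0_mul f (C0_autz h n g)).
  by rewrite /F -muM ell1_mul_delta.
have F0M f g n : F 0 f * F n g = F n (C0_mul f g) by rewrite FM add0r.
(* If F 0 vanished, every F n would vanish on all products f g, hence
   everywhere, and mu would be zero. *)
have F0_neq0 : exists f, F 0 f != 0.
  apply: contrapT => /forallNP F00; move/eqP: a00; apply.
  have {}F00 f : F 0 f = 0 by apply/eqP/negPn/negP; exact: F00.
  have Fn0 n f : F n f = 0.
    apply: (C0_functional_eq0 (lF n) (bF n)) => x; have [g gx] := sep x.
    by exists g => // g'; rewrite -F0M F00 mul0r.
  have z0 : linear (fun _ : E => 0 : R[i]^o) by move=> z a b; rewrite scaler0 addr0.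
  have zb : lbounded (fun _ : E => 0 : R[i]^o).
    by exists 0 => // a; rewrite mul0r rnorm0.
  exact: (eq_on_delta lmu z0 bmu zb (fun n f => Fn0 n f)).
have [x Fx] : exists x, forall f, F 0 f = f x.
  by apply: C0_character_eval => //; split=> // f g; rewrite F0M.
have [e' e'x] := sep x; pose e : C0X := (e' x)^-1 *: e'.
have ex : e x = 1 by exact: mulVf.
pose c n : R[i] := F n e.
have Fc n f : F n f = f x * c n.
  have := F0M e f n; have := F0M f e n; rewrite !Fx ex mul1r => ->.
  by move=> ->; congr F; apply: C0_ext => y; exact: mulrC.
have rel n f : c 1 * (f x * c n) = f (homeo_inv h x) * c (n + 1).
  have := FM e f 1 n; rewrite [F 1 e]Fc ex mul1r [F n f]Fc [F (1 + n) _]Fc.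
  by rewrite -[C0_mul _ _ x]/(e x * f (homeo_inv h x)) ex mul1r [1 + n]addrC.
have c0 : c 0 = 1 by rewrite /c Fx.
have [g gx] := sep (homeo_inv h x).
(* For n = -1 the relation expresses g (homeo_inv h x) as a multiple of c 1. *)
have xi0 : c 1 != 0.
  apply: contra gx => /eqP c10; have := rel (-1) g.
  by rewrite c10 mul0r addNr c0 mulr1 => <-.
have fix_x f : f (homeo_inv h x) = f x.
  by have := rel 0 f; rewrite add0r c0 mulr1 mulrC => /(mulIf xi0).
have cS n : c (n + 1) = c 1 * c n.
  by have := rel n e; rewrite fix_x ex !mul1r.
have xiS n : c 1 * c 1 ^ n = c 1 ^ (n + 1) by rewrite expfzDr// expr1z mulrC.
have cE n : c n = c 1 ^ n.
  elim/int_ind: n => [|n IH|n IH]; first by rewrite c0 expr0z.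
    by rewrite -addn1 PoszD cS IH xiS.
  apply: (mulfI xi0); rewrite -cS xiS (_ : - n.+1%:Z + 1 = - n%:Z)//.
  by lia.
exists x, (c 1); split=> //; last by move=> n f; rewrite -cE -Fc.
(* All integer powers of c 1 are bounded by B, so neither c 1 nor its inverse
   can have modulus above 1. *)
have [C C0' hC] := bmu.
pose B := C * supnorm e.
have pow_le n : normc (c 1 ^ n) <= B.
  by rewrite -cE; apply: le_trans (hC _) _; rewrite ell1_rnormE ell1norm_delta.
have B0 : 0 <= B by apply: le_trans (pow_le 0); exact: normc_ge0.
have le1 (z : R[i]) : (forall n : nat, normc (z ^+ n) <= B) -> normc z <= 1.
  move=> zB; rewrite leNgt; apply/negP => z1.
  have nX n : normc (z ^+ n) = normc z ^+ n.
    elim: n => [|n IH]; first by rewrite !expr0 normc1.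
    by rewrite !exprS normcM IH.
  pose d := normc z - 1; have d0 : 0 < d by rewrite subr_gt0.
  have bern n : 1 + n%:R * d <= normc z ^+ n.
    elim: n => [|n IH]; first by rewrite mul0r addr0 expr0.
    have -> : normc z ^+ n.+1 = (1 + d) * normc z ^+ n.
      by rewrite exprS /d addrC subrK.
    have n0 : 0 <= n%:R * d :> R by rewrite mulr_ge0// ltW.
    by rewrite -natr1; nra.
  have [n nB] : exists n : nat, B < n%:R * d.
    by exists (Num.Def.archi_bound (B / d)); rewrite -ltr_pdivrMr// archi_boundP// divr_ge0// ltW.
  have := bern n; have := zB n; rewrite nX; lra.
apply/eqP; rewrite eq_le; apply/andP; split; first by apply: le1 => n; exact: (pow_le n).
have : normc (c 1)^-1 <= 1.
  by apply: le1 => n; rewrite exprVn; have := pow_le (- n%:Z); rewrite -exprnN.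
by rewrite normcV invf_le1// normc_gt0.
Qed.

Lemma character_ext mu nu : is_character mul mu -> is_character mul nu ->
  (forall n f, mu (delta f n) = nu (delta f n)) -> mu = nu.
Proof.
move=> cmu cnu mn; apply/funext; have [lmu _ _] := cmu; have [lnu _ _] := cnu.
by apply: eq_on_delta => //; exact: character_lbounded.
Qed.

Section PointFunctional.
Context (x : X) (xi : R[i]) (xi1 : normc xi = 1) (hx : h x = x) (x_neq0 : exists f, f x != 0).

(** The explicit form of the functional whose kernel is I(x, xi). *)
Definition point_sum (a : E) : R[i]^o := zsum (fun n => a n x * xi ^ n : R[i]^o).

Lemma normc_exprz n : normc (xi ^ n) = 1.
Proof.
have nX k : normc (xi ^+ k) = 1.
  elim: k => [|k IH]; first by rewrite expr0 normc1.
  by rewrite exprS normcM IH xi1 mulr1.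
by case: n => k; [exact: nX|rewrite NegzE -exprnN normcV nX invr1].
Qed.

Lemma point_sum_bounded a : abs_bounded (fun n => a n x * xi ^ n : R[i]^o) (ell1norm a).
Proof.
move=> N; have /ell1norm_leP/(_ N) := lexx (ell1norm a); apply: le_trans.
apply: ler_symsum => n; rewrite -[leLHS]/(normc (a n x * xi ^ n)).
by rewrite normcM normc_exprz mulr1; exact: supnorm_ub.
Qed.

Lemma point_sum_linear : linear point_sum.
Proof.
move=> z a b; rewrite /point_sum.
rewrite -(zsum_linear _ complex_seq_complete (point_sum_bounded a) (point_sum_bounded b)).
congr zsum; apply/funext => n.
rewrite -[(z *: a + b) n x]/(z * a n x + b n x) mulrDl; congr (_ + _).
exact/esym/mulrA.
Qed.

Lemma point_sum_lbounded : lbounded point_sum.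
Proof.
exists 1 => // a; rewrite mul1r.
exact: rnorm_zsum complex_seq_complete (point_sum_bounded a).
Qed.

Lemma point_sum_delta n f : point_sum (delta f n) = f x * xi ^ n.
Proof.
have cvg_n : symsum (fun m => delta f n m x * xi ^ m : R[i]^o) @ \oo --> (f x * xi ^ n : R[i]^o).
  apply/seq_cvgP => e e0; exists `|n|%N => N nN.
  have lt : (absz (n + N%:Z)%R < N.*2.+1)%N by lia.
  rewrite /symsum (bigD1 (Ordinal lt))//= big1 ?addr0.
    have -> : (absz (n + N%:Z)%R)%:Z - N%:Z = n by lia.
    by rewrite eqxx subrr rnorm0.
  move=> i /eqP ni; case: eqP => [e'|_]; last exact: mul0r.
  by exfalso; apply: ni; apply: val_inj => /=; lia.
exact: zsum_unique cvg_n.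
Qed.

Lemma homeo_pow_fixed n : homeo_pow h n x = x.
Proof.
have ix : homeo_inv h x = x by rewrite -{1}hx homeo_funK.
case: n => k; rewrite /homeo_pow; first by elim: k => // k IH; rewrite iterS IH.
by elim: k.+1 => // {}k IH; rewrite iterS IH.
Qed.

(** Reduced to monomials by density; there it says that evaluation at the fixed
    point x does not see the twist. *)
Lemma point_sum_mul a b : point_sum (mul a b) = point_sum a * point_sum b.
Proof.
have xi0 : xi != 0.
  by apply/eqP => xi0; move/eqP: xi1; rewrite xi0 normc0 eq_sym oner_eq0.
have ls (z : R[i]^o) : linear (fun w : R[i]^o => (z * w : R[i]^o)).
  by move=> t v w; rewrite mulrDr; congr (_ + _); exact: mulrCA.
have bs (z : R[i]^o) : lbounded (fun w : R[i]^o => (z * w : R[i]^o)).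
  by exists (normc z) => [|w]; [exact: normc_ge0|rewrite -[leLHS]/(normc (z * w)) normcM].
have ls' (z : R[i]^o) : linear (fun w : R[i]^o => (w * z : R[i]^o)).
  by move=> t v w; rewrite mulrC ls !(mulrC z).
have bs' (z : R[i]^o) : lbounded (fun w : R[i]^o => (w * z : R[i]^o)).
  by have [C C0' hC] := bs z; exists C => // w; rewrite mulrC.
have pl := point_sum_linear; have pb := point_sum_lbounded.
have ll := @ell1_mul_linearl R X h; have lr := @ell1_mul_linearr R X h.
have bl := @ell1_mul_lboundedl R X h; have br := @ell1_mul_lboundedr R X h.
have step n m f g : point_sum (mul (delta f n) (delta g m)) =
    point_sum (delta f n) * point_sum (delta g m).
  rewrite ell1_mul_delta !point_sum_delta -[C0_mul _ _ x]/(f x * C0_autz h n g x).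
  by rewrite C0_autzE homeo_pow_fixed expfzDr// mulrACA.
have step' n f c : point_sum (mul (delta f n) c) = point_sum (delta f n) * point_sum c.
  move: c; apply: (eq_on_delta (linear_comp (lr _) pl) (linear_comp pl (ls _))
    (lbounded_comp (br _) pb) (lbounded_comp pb (bs _))) => m g; exact: step.
move: a; apply: (eq_on_delta (linear_comp (ll _) pl) (linear_comp pl (ls' _))
    (lbounded_comp (bl _) pb) (lbounded_comp pb (bs' _))) => n f; exact: step'.
Qed.

Lemma point_sum_character : is_character mul point_sum.
Proof.
split; [exact: point_sum_linear|exact: point_sum_mul|].
by have [f fx] := x_neq0; exists (delta f 0); rewrite point_sum_delta expr0z mulr1.
Qed.

End PointFunctional.

Lemma point_functional_eq mu x (xi : R[i]) : is_character mul mu ->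
  (forall n f, mu (delta f n) = f x * xi ^ n) -> point_functional h x xi = mu.
Proof.
move=> cmu mud; rewrite /point_functional; apply: xget_unique => //.
  split=> // nu [cnu nud]; apply: character_ext => // n f.
  by rewrite mud nud.
by move=> nu [[cnu nud] _]; apply: character_ext => // n f; rewrite mud nud.
Qed.

Lemma kernel_closed (V W : normedModType R[i]) (L : V -> W) :
  linear L -> lbounded L -> closed [set a | L a = 0].
Proof.
move=> lL [C C0' hC] a cla; apply: rnorm_le_eps => e e0.
have C1 : 0 < C + 1 by lra.
have aF : Filter (nbhs a) by exact: nbhs_filter.
have /cvg_rnormP/(_ _ (divr_gt0 e0 C1)) ae : (fun b : V => b) @ a --> a by exact: cvg_id.
have [b [/= Lb]] := cla _ ae.
rewrite ltr_pdivlMr// => ab; rewrite -[L a]subr0 -Lb -linear_sub//.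
apply: le_trans (hC _) _; apply: le_trans (ltW ab); rewrite mulrC.
by rewrite ler_wpM2l ?rnorm_ge0// lerDl.
Qed.

(** A functional with mu a0 != 0 splits E as its kernel plus the line of a0. The
    kernel is closed, which puts the closed commutator ideal inside it. *)
Lemma character_ker_maximal mu : is_character mul mu ->
  [/\ is_maximal_ideal mul [set a | mu a = 0],
      is_modular mul [set a | mu a = 0] &
      commutator_ideal mul `<=` [set a | mu a = 0]].
Proof.
move=> cmu; have [lmu muM [a0 a00]] := cmu; have bmu := character_lbounded cmu.
have idl : is_ideal mul [set a | mu a = 0].
  split=> /= [|z a b pa pb|a b pb]; first exact: linear_zero.
    by rewrite lmu pa pb scaler0 addr0.
  by rewrite !muM pb mulr0 mul0r.
split.
- split=> //; first by apply/eqP => kT; move/eqP: a00; apply; rewrite -[_ = _]/([set a | mu a = 0] a0) kT.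
  move=> J idJ kJ; have [[b [Jb b0]]|/forallNP nJ] := pselect (exists b, J b /\ mu b != 0).
    right; rewrite -subTset => a _.
    rewrite -[a](subrK (mu a / mu b *: b)); apply: (idealD idJ).
      apply: kJ => /=; rewrite linear_sub// linear_scale//.
      by rewrite [_ *: _]divfK// subrr.
    exact: (idealZ idJ).
  left; apply/seteqP; split=> // a Ja /=; apply/eqP/negPn/negP => a1.
  by apply: (nJ a).
- exists ((mu a0)^-1 *: a0) => a /=.
  have u1 : mu ((mu a0)^-1 *: a0) = 1 by rewrite linear_scale//; exact: mulVf.
  by rewrite !linear_sub// !muM u1 mul1r mulr1 subrr.
- move=> a; apply; split=> //; last by move=> b c /=; rewrite linear_sub// !muM mulrC subrr.
  exact: kernel_closed.
Qed.

End CharactersOfEll1.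

(** * The maximal modular ideals containing all commutators *)

Theorem theorem7p6 (R : realType) (A : commCStarAlgType R) (sigma : cstarAut A)
    (I : set (ell1 R (spectrum A))) :
  let h := spectrum_homeo sigma in
  [/\ is_maximal_ideal (ell1_mul h) I,
      is_modular (ell1_mul h) I &
      commutator_ideal (ell1_mul h) `<=` I] <->
  exists (x : spectrum A) (xi : R[i]),
    [/\ fixed_points h x, `|xi| = 1 & I = point_ideal h x xi].
Proof.
move=> h; split=> [[maxI [u uI] commI]|[x [xi [hx xi1 ->]]]].
  have comm a b : I (ell1_mul h a b - ell1_mul h b a).
    by apply: commI => J [_ _]; exact.
  have [mu cmu ->] := maximal_modular_character (ell1_normed_product h) (@ell1_mulA _ _ h)
    ell1_seq_complete maxI comm uI.
  have [x [xi [fx xi1 mud]]] := character_delta cmu (@C0_spectrum_neq0 R A).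
  exists x, xi; split; last by rewrite /point_ideal (point_functional_eq cmu mud).
    apply: (can_inj (homeo_invK h)); rewrite homeo_funK.
    by apply/esym/spectrum_ext.
  by rewrite -[LHS]/((normc xi)%:C) xi1.
have nxi : normc xi = 1 by move: xi1 => [].
have cx := point_sum_character nxi hx (C0_spectrum_neq0 x).
have xd := point_sum_delta x xi.
by rewrite /point_ideal (point_functional_eq cx xd); exact: character_ker_maximal.
Qed.
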